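(* Let $P_1,\ldots,P_k$ be nonzero complex polynomials of one variable, let $v_1,\ldots,v_k\in\mathbb{R}^n\setminus\{0\}$, and let $K\subset\mathbb{R}^n$ be a compact set which is $(v_1,\ldots,v_k)$-normal with a smooth surface. Then the operator $P(D)=P_1(D_{v_1})\circ\cdots\circ P_k(D_{v_k}):\mathcal{E}(K)\to\mathcal{E}(K)$ admits a continuous linear right inverse, i.e. there is a continuous linear operator $S:\mathcal{E}(K)\to\mathcal{E}(K)$ with $P(D)\circ S=\operatorname{id}_{\mathcal{E}(K)}$.
   Context: Fix $n\in\mathbb{N}$. $\mathcal{E}(\mathbb{R}^n)$ is the space of smooth complex-valued functions on $\mathbb{R}^n$ with its natural Fréchet topology (uniform convergence of all derivatives on compact sets); $D_j=\partial/\partial x_j$ and $D^\beta=D_1^{\beta_1}\cdots D_n^{\beta_n}$ for $\beta\in\mathbb{N}_0^n$. For a compact set $K\subset\mathbb{R}^n$ let $r_K:\mathcal{E}(\mathbb{R}^n)\to\prod_{\beta\in\mathbb{N}_0^n}C(K)$, $r_KF=((D^\beta F)|_K)_{\beta\in\mathbb{N}_0^n}$. The space of Whitney functions on $K$ is $\mathcal{E}(K)=\{f=(f^\beta)_{\beta\in\mathbb{N}_0^n}: r_KF=f \text{ for some } F\in\mathcal{E}(\mathbb{R}^n)\}$, with the finest topology making $r_K:\mathcal{E}(\mathbb{R}^n)\to\mathcal{E}(K)$ continuous (the quotient topology); it is a Fréchet space. On $\mathcal{E}(K)$ one sets $D_jf=(f^{\beta+e_j})_{\beta\in\mathbb{N}_0^n}$,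 where $e_j$ is the $j$-th standard unit vector, and $D_v=\sum_{j=1}^n v_jD_j$ for $v=(v_1,\ldots,v_n)\in\mathbb{R}^n$; for a one-variable polynomial $p(t)=\sum_i a_it^i$, $p(D_v)=\sum_i a_iD_v^i$. For $v\in\mathbb{R}^n$ let $H_v=\{x\in\mathbb{R}^n:\langle x,v\rangle=0\}$, where $\langle\cdot,\cdot\rangle$ is the standard scalar product. A set $K\subset\mathbb{R}^n$ is $(v_1,\ldots,v_k)$-normal if for each $m=1,\ldots,k$ there exist a compact set $K_{v_m}\subset H_{v_m}$ and functions $\phi_{v_m},\psi_{v_m}:K_{v_m}\to\mathbb{R}$ with $\phi_{v_m}\le\psi_{v_m}$ such that $K=\{tv_m+x: x\in K_{v_m},\ t\in[\phi_{v_m}(x),\psi_{v_m}(x)]\}$. It is $(v_1,\ldots,v_k)$-normal with a smooth surface if moreover for each $m$ there exists $\gamma_{v_m}=(\gamma_{v_m}^\beta)_\beta\in\mathcal{E}(K_{v_m})$ (Whitney functions on the compact subset $K_{v_m}$ of $\mathbb{R}^n$) such that $\phi_{v_m}\le\gamma_{v_m}^0\le\psi_{v_m}$ on $K_{v_m}$. *)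

(* Defs.v *)
From HB Require Import structures.
From mathcomp Require Import all_boot all_order all_algebra.
From mathcomp Require Import complex ring.
From mathcomp Require Import all_classical all_reals all_analysis.
Set Implicit Arguments.
Unset Strict Implicit.
Unset Printing Implicit Defensive.
Import Order.TTheory GRing.Theory Num.Theory numFieldNormedType.Exports.
Local Open Scope classical_set_scope.
Local Open Scope complex_scope.
Local Open Scope ring_scope.

(* The usual topology of the complex numbers, given by the modulus. *)
HB.instance Definition _ (R : rcfType) := NormedModule.copy R[i] (R[i])^o.

Section mixed_derivatives.
Variables (R : realType) (V : normedModType R).
Implicit Types (f : V -> R) (x u v : V).

Lemma is_derive_line f x u (s : R) : derivable f (x + s *: u) u ->
  is_derive s 1 (fun t : R => f (x + t *: u)) ('D_u f (x + s *: u)).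
Proof.
move=> df.
have E : (fun h : R => h^-1 *: (((fun t : R => f (x + t *: u)) \o shift s) (h *: (1 : R))
            - f (x + s *: u))) =
         (fun h : R => h^-1 *: ((f \o shift (x + s *: u)) (h *: u) - f (x + s *: u))).
  apply/funext => h /=; congr (_ *: (f _ - _)).
  by rewrite [h *: 1]mulr1 scalerDl addrCA.
by split; [rewrite /derivable E | rewrite /derive E].
Qed.

Lemma second_difference f x u v (h : R) : 0 < h ->
  (forall y, derivable f y u) -> (forall y, derivable ('D_u f) y v) ->
  exists s t : R, [/\ s \in `]0, h[, t \in `]0, h[ &
    f (x + h *: v + h *: u) - f (x + h *: u) - (f (x + h *: v) - f x) =
    'D_v ('D_u f) (x + s *: u + t *: v) * h * h].
Proof.
move=> h0 du dvu.
pose g (t : R) := f (x + h *: v + t *: u) - f (x + t *: u).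
have dg (t : R) : is_derive t (1 : R) g
    ('D_u f (x + h *: v + t *: u) - 'D_u f (x + t *: u)).
  by apply: is_deriveB; apply: is_derive_line.
have cg : {within `[0, h], continuous g}.
  by apply: derivable_within_continuous => t _; case: (dg t).
have [s sI gE] := MVT h0 (fun t _ => dg t) cg.
pose k (t : R) := 'D_u f (x + s *: u + t *: v).
have dk (t : R) : is_derive t (1 : R) k ('D_v ('D_u f) (x + s *: u + t *: v)).
  exact: is_derive_line.
have ck : {within `[0, h], continuous k}.
  by apply: derivable_within_continuous => t _; case: (dk t).
have [t tI kE] := MVT h0 (fun t _ => dk t) ck.
exists s, t; split => //.
move: gE kE; rewrite /g /k !scale0r !addr0 !subr0 => -> kE.
by rewrite -kE [x + _ + h *: v]addrAC.
Qed.

Lemma derive_comm f u v :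
  (forall y, derivable f y u) -> (forall y, derivable f y v) ->
  (forall y, derivable ('D_u f) y v) -> (forall y, derivable ('D_v f) y u) ->
  continuous ('D_v ('D_u f)) -> continuous ('D_u ('D_v f)) ->
  'D_v ('D_u f) = 'D_u ('D_v f).
Proof.
move=> du dv dvu duv cvu cuv; apply/funext => x.
apply/eqP; rewrite -subr_eq0 -normr_le0; apply/ler_addgt0Pl => e e0.
rewrite addr0.
have e20 : 0 < e / 2 by rewrite divr_gt0.
have /cvgrPdist_lt/(_ _ e20) := cvu x; have /cvgrPdist_lt/(_ _ e20) := cuv x.
move=> /nbhs_ballP[d1 /= d10 B1] /nbhs_ballP[d2 /= d20 B2].
pose d := Num.min d1 d2.
have d0 : 0 < d by rewrite lt_min d10.
pose M := `|u| + `|v| + 1.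
have M0 : 0 < M by rewrite ltr_wpDl// addr_ge0.
pose h := d / M.
have h0 : 0 < h by rewrite divr_gt0.
have near s t a b : s \in `]0, h[ -> t \in `]0, h[ -> `|a| + `|b| + 1 = M ->
    ball x d (x + s *: a + t *: b).
  rewrite !in_itv/= => /andP[s0 sh] /andP[t0 th] abM.
  rewrite -ball_normE /ball_ /= -addrA opprD addNKr normrN.
  apply: le_lt_trans (ler_normD _ _) _.
  rewrite !normrZ !gtr0_norm//.
  have : h * M = d by rewrite /h divfK// gt_eqF.
  move=> <-; rewrite -abM !mulrDr mulr1.
  apply: le_lt_trans (lerD (ler_wpM2r (normr_ge0 a) (ltW sh))
    (ler_wpM2r (normr_ge0 b) (ltW th))) _.
  by rewrite ltrDl.
have [s [t [sI tI E1]]] := second_difference x h0 du dvu.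
have [s' [t' [sI' tI' E2]]] := second_difference x h0 dv duv.
have E : 'D_v ('D_u f) (x + s *: u + t *: v) =
         'D_u ('D_v f) (x + s' *: v + t' *: u).
  apply: (mulIf (lt0r_neq0 h0)); apply: (mulIf (lt0r_neq0 h0)).
  apply: etrans (etrans (esym E1) _) E2; rewrite [x + h *: u + h *: v]addrAC.
  move: (f _) (f (x + _)) (f (x + _)) (f x) => a b c d'.
  by ring.
have P1 : ball x d2 (x + s *: u + t *: v).
  by apply: le_ball (near _ _ _ _ sI tI _); rewrite ?ge_min ?lexx ?orbT.
have P2 : ball x d1 (x + s' *: v + t' *: u).
  apply: le_ball (near _ _ _ _ sI' tI' _); first by rewrite ge_min lexx.
  by rewrite [`|v| + _]addrC.
move: (B2 _ P1) (B1 _ P2) => /=; rewrite E.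
move: ('D_u ('D_v f) _) ('D_v _ x) ('D_u _ x) => a b c ba ca.
rewrite (splitr e) -(subrKA a).
apply: le_trans (ler_normD _ _) _; apply: lerD; first exact: ltW.
by rewrite distrC; exact: ltW.
Qed.

Lemma derive_comm_eq f fu fv fuv fvu u v :
  fu = 'D_u f -> fv = 'D_v f -> fuv = 'D_v fu -> fvu = 'D_u fv ->
  (forall y, derivable f y u) -> (forall y, derivable f y v) ->
  (forall y, derivable fu y v) -> (forall y, derivable fv y u) ->
  continuous fuv -> continuous fvu -> fuv = fvu.
Proof. by move=> -> -> -> ->; exact: derive_comm. Qed.

Lemma derive_lin f g h (a b : R) x v :
  derivable f x v -> derivable g x v -> derivable h x v ->
  derivable (a *: f + b *: g + h) x v /\
  'D_v (a *: f + b *: g + h) x = a * 'D_v f x + b * 'D_v g x + 'D_v h x.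
Proof.
move=> df dg dh.
have daf : derivable (a *: f) x v by exact: derivableZ.
have dbg : derivable (b *: g) x v by exact: derivableZ.
have dab : derivable (a *: f + b *: g) x v by exact: derivableD.
split; first exact: derivableD.
by rewrite (deriveD dab dh) (deriveD daf dbg) (deriveZ _ df) (deriveZ _ dg).
Qed.

End mixed_derivatives.

Section smooth.
Variables (R : realType) (n : nat).
Local Notation Rn := 'rV[R]_n.
Implicit Types (F G : Rn -> R[i]) (s : seq 'I_n) (j : 'I_n).

Definition unitv j : Rn := delta_mx 0 j.

Definition partial j F : Rn -> R[i] := fun x =>
  'D_(unitv j) (@complex.Re R \o F) x +i* 'D_(unitv j) (@complex.Im R \o F) x.

Definition has_partial j F := forall x : Rn,
  derivable (@complex.Re R \o F) x (unitv j) /\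
  derivable (@complex.Im R \o F) x (unitv j).

(* partials [:: j1; ...; jr] F = D_j1 (... (D_jr F)) *)
Definition partials s F : Rn -> R[i] := foldr partial F s.

(* All iterated partial derivatives, in any order, exist and are continuous. *)
Definition smooth F : Prop := forall s,
  continuous (partials s F) /\ forall j, has_partial j (partials s F).

Definition smooth_pred : {pred Rn -> R[i]} := fun F => `[< smooth F >].

Record smooth_fun := SmoothFun {
  smooth_val :> Rn -> R[i];
  smooth_valP : smooth_val \in smooth_pred }.

HB.instance Definition _ := [isSub for smooth_val].
HB.instance Definition _ := [Choice of smooth_fun by <:].

Definition multi_index := {ffun 'I_n -> nat}.

Definition multi_word (b : multi_index) : seq 'I_n :=
  flatten [seq nseq (b j) j | j <- enum 'I_n].

Definition multiD (b : multi_index) F : Rn -> R[i] := partials (multi_word b) F.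

Definition incr_multi (b : multi_index) j : multi_index :=
  [ffun i => (b i + (i == j))%N].

Lemma partials_rcons s j F : partials (rcons s j) F = partials s (partial j F).
Proof. by rewrite /partials foldr_rcons. Qed.

Lemma smooth_partial j F : smooth F -> smooth (partial j F).
Proof. by move=> sF s; rewrite -partials_rcons; exact: sF. Qed.

Lemma smooth_partials s F : smooth F -> smooth (partials s F).
Proof. by move=> sF; elim: s => [//|j s IHs]; exact: smooth_partial IHs. Qed.

Lemma continuous_Re : continuous (@complex.Re R : R[i] -> R).
Proof.
move=> z; apply/(cvgrPdist_lt (FF := nbhs_filter z)) => e e0.
apply/nbhs_ballP; exists e%:C => /=; first by rewrite ltcR.
move=> y; rewrite -ball_normE /ball_ /= -ltcR; apply: le_lt_trans.
by have := normc_ge_Re (z - y); case: z y => [a b] [c d].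
Qed.

Lemma continuous_Im : continuous (@complex.Im R : R[i] -> R).
Proof.
have -> : (@complex.Im R : R[i] -> R) = @complex.Re R \o (fun z => (- 'i) * z).
  by apply/funext => -[a b] /=; rewrite oppr0 mul0r mulN1r opprK add0r.
move=> z; apply: continuous_comp; last exact: continuous_Re.
exact: mulrl_continuous.
Qed.

Lemma partialC i j F : smooth F -> partial i (partial j F) = partial j (partial i F).
Proof.
move=> sF; have [_ d0] := sF [::].
have [_ dj] := sF [:: j]; have [_ di] := sF [:: i].
have [cij _] := sF [:: i; j]; have [cji _] := sF [:: j; i].
have cR G : continuous G -> continuous (@complex.Re R \o G).
  by move=> cG x; apply: continuous_comp; [exact: cG|exact: continuous_Re].
have cI G : continuous G -> continuous (@complex.Im R \o G).
  by move=> cG x; apply: continuous_comp; [exact: cG|exact: continuous_Im].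
have ReE G k : @complex.Re R \o partial k G = 'D_(unitv k) (@complex.Re R \o G).
  exact/funext.
have ImE G k : @complex.Im R \o partial k G = 'D_(unitv k) (@complex.Im R \o G).
  exact/funext.
have RC := derive_comm_eq (ReE F j) (ReE F i) (ReE _ i) (ReE _ j)
  (fun y => proj1 (d0 j y)) (fun y => proj1 (d0 i y))
  (fun y => proj1 (dj i y)) (fun y => proj1 (di j y)) (cR _ cij) (cR _ cji).
have IC := derive_comm_eq (ImE F j) (ImE F i) (ImE _ i) (ImE _ j)
  (fun y => proj2 (d0 j y)) (fun y => proj2 (d0 i y))
  (fun y => proj2 (dj i y)) (fun y => proj2 (di j y)) (cI _ cij) (cI _ cji).
have complex_inj (z w : R[i]) :
    complex.Re z = complex.Re w -> complex.Im z = complex.Im w -> z = w.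
  by case: z w => a b [c d] /= -> ->.
apply/funext => x.
exact: complex_inj (congr1 (@^~ x) RC) (congr1 (@^~ x) IC).
Qed.

Lemma partials_partialC s j F : smooth F ->
  partials s (partial j F) = partial j (partials s F).
Proof.
by move=> sF; elim: s => //= i s ->; exact/partialC/smooth_partials.
Qed.

Lemma partials_perm s t F : smooth F -> perm_eq s t ->
  partials s F = partials t F.
Proof.
move=> sF; elim: s t => [|j s IHs] t.
  by rewrite perm_sym => /perm_nilP ->.
move=> st; have jt : j \in t by rewrite -(perm_mem st) mem_head.
case/splitPr: jt st => p q st.
have {}st : perm_eq s (p ++ q).
  by move: st; rewrite perm_sym perm_catC/= perm_cons perm_sym => /perm_trans->//;
    rewrite perm_catC.
rewrite /= (IHs _ st) /partials !foldr_cat /= -/(partials q F).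
by symmetry; apply: partials_partialC; exact: smooth_partials.
Qed.

Lemma multiD_incr b j F : smooth F ->
  multiD (incr_multi b j) F = multiD b (partial j F).
Proof.
move=> sF; rewrite /multiD -partials_rcons; apply: partials_perm => //.
apply/permP => a; rewrite -cats1 count_cat /multi_word !count_flatten -!map_comp.
rewrite !sumnE !big_map /= addn0.
under eq_bigr do rewrite count_nseq ffunE mulnDr.
under [in RHS]eq_bigr do rewrite count_nseq.
rewrite big_split /=; congr addn; rewrite -enumT.
rewrite (bigD1_seq j) ?mem_enum ?enum_uniq//= eqxx muln1 big1 ?addn0//.
by move=> i /negPf ->; rewrite muln0.
Qed.

Lemma partial_lin (a : R[i]) j F G : has_partial j F -> has_partial j G ->
  has_partial j (a *: F + G) /\
  partial j (a *: F + G) = a *: partial j F + partial j G.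
Proof.
move=> dF dG.
have ReE : @complex.Re R \o (a *: F + G) =
    complex.Re a *: (@complex.Re R \o F) + (- complex.Im a) *: (@complex.Im R \o F)
    + (@complex.Re R \o G).
  apply/funext => x /=; rewrite !fctE.
  by move: (a) (F x) (G x) => [? ?] [? ?] [? ?] /=; rewrite scaleNr.
have ImE : @complex.Im R \o (a *: F + G) =
    complex.Re a *: (@complex.Im R \o F) + complex.Im a *: (@complex.Re R \o F)
    + (@complex.Im R \o G).
  apply/funext => x /=; rewrite !fctE.
  by move: (a) (F x) (G x) => [? ?] [? ?] [? ?] /=.
have dRe x := derive_lin (complex.Re a) (- complex.Im a)
  (proj1 (dF x)) (proj2 (dF x)) (proj1 (dG x)).
have dIm x := derive_lin (complex.Re a) (complex.Im a)
  (proj2 (dF x)) (proj1 (dF x)) (proj2 (dG x)).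
split=> [x|].
  rewrite ReE ImE; split; [exact: proj1 (dRe x)|exact: proj1 (dIm x)].
apply/funext => x; rewrite {1}/partial ReE ImE.
rewrite (proj2 (dRe x)) (proj2 (dIm x)) !fctE /partial.
move: ('D_(unitv j) (@complex.Re R \o F) x) ('D_(unitv j) (@complex.Im R \o F) x).
move: ('D_(unitv j) (@complex.Re R \o G) x) ('D_(unitv j) (@complex.Im R \o G) x).
move=> r s p q; move: (a) => [a1 a2].
by congr (_ +i* _); rewrite /= mulNr.
Qed.

Lemma partials_lin (a : R[i]) s F G : smooth F -> smooth G ->
  partials s (a *: F + G) = a *: partials s F + partials s G.
Proof.
move=> sF sG; elim: s => //= j s ->.
exact: proj2 (partial_lin a (proj2 (sF s) j) (proj2 (sG s) j)).
Qed.

Lemma smooth_lin (a : R[i]) F G : smooth F -> smooth G -> smooth (a *: F + G).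
Proof.
move=> sF sG s; rewrite partials_lin//; have [cF dF] := sF s; have [cG dG] := sG s.
split=> [x|j].
  by apply: continuousD; [apply: continuousZr; exact: cF|exact: cG].
exact: proj1 (partial_lin a (dF j) (dG j)).
Qed.

Lemma partial0 j : partial j 0 = 0.
Proof.
apply/funext => x; rewrite /partial.
have -> : @complex.Re R \o (0 : Rn -> R[i]) = cst 0 by apply/funext.
have -> : @complex.Im R \o (0 : Rn -> R[i]) = cst 0 by apply/funext.
by rewrite !derive_cst.
Qed.

Lemma smooth0 : smooth 0.
Proof.
move=> s; have -> : partials s 0 = 0 by elim: s => //= j s ->; exact: partial0.
split=> [|j x]; first exact: (@cst_continuous Rn R[i] 0).
have -> : @complex.Re R \o (0 : Rn -> R[i]) = cst 0 by apply/funext.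
have -> : @complex.Im R \o (0 : Rn -> R[i]) = cst 0 by apply/funext.
by split; exact: derivable_cst.
Qed.

Lemma smooth_submod_closed : GRing.submod_closed smooth_pred.
Proof.
split; first exact/asboolP/smooth0.
by move=> a F G /asboolP sF /asboolP sG; apply/asboolP/smooth_lin.
Qed.

HB.instance Definition _ :=
  GRing.isSubmodClosed.Build _ _ smooth_pred smooth_submod_closed.
HB.instance Definition _ := [SubChoice_isSubLmodule of smooth_fun by <:].

(* The Frechet topology: uniform convergence on compact sets of every
   derivative. *)
Definition all_derivatives (F : smooth_fun) :
    prod_topology (fun _ : multi_index => {family compact, Rn -> R[i]}) :=
  fun b => multiD b F.

HB.instance Definition _ :=
  Topological.copy smooth_fun (initial_topology all_derivatives).

End smooth.

Arguments multi_index : clear implicits.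
Arguments smooth_fun : clear implicits.

Section whitney.
Variables (R : realType) (n : nat) (K : set 'rV[R]_n).
Local Notation family := (multi_index n -> K -> R[i]).

Definition jet_on (F : 'rV[R]_n -> R[i]) : family :=
  fun b x => multiD b F (val x).

Definition whitney_pred : {pred family} :=
  fun f => `[< exists F : smooth_fun R n, jet_on F = f >].

Record whitney := Whitney {
  whitney_val :> family;
  whitney_valP : whitney_val \in whitney_pred }.

HB.instance Definition _ := [isSub for whitney_val].
HB.instance Definition _ := [Choice of whitney by <:].

Lemma whitney_submod_closed : GRing.submod_closed whitney_pred.
Proof.
have jetE (a : R[i]) (F G : smooth_fun R n) :
    jet_on (a *: F + G) = a *: jet_on F + jet_on G.
  apply/funext => b; apply/funext => x; rewrite /jet_on /multiD /=.
  by rewrite partials_lin//; [exact/asboolP/(valP F)|exact/asboolP/(valP G)].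
split.
  apply/asboolP; exists 0.
  have := jetE (-1) 0 0; rewrite scaler0 addr0 => ->.
  by rewrite scaleN1r addNr.
move=> a _ _ /asboolP[F <-] /asboolP[G <-]; apply/asboolP.
by exists (a *: F + G); exact: jetE.
Qed.

HB.instance Definition _ :=
  GRing.isSubmodClosed.Build _ _ whitney_pred whitney_submod_closed.
HB.instance Definition _ := [SubChoice_isSubLmodule of whitney by <:].

Lemma jet_on_whitney (F : smooth_fun R n) : jet_on F \in whitney_pred.
Proof. by apply/asboolP; exists F. Qed.

Definition whitney_of (F : smooth_fun R n) : whitney :=
  Whitney (jet_on_whitney F).

Definition whitney_open : set (set whitney) :=
  [set U | open (whitney_of @^-1` U)].

Lemma whitney_openT : whitney_open setT.
Proof. by rewrite /whitney_open /= preimage_setT; exact: openT. Qed.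

Lemma whitney_openI : setI_closed whitney_open.
Proof. by move=> U V oU oV; rewrite /whitney_open /= preimage_setI; exact: openI. Qed.

Lemma whitney_open_bigcup (I : Type) (U : I -> set whitney) :
  (forall i, whitney_open (U i)) -> whitney_open (\bigcup_i U i).
Proof.
move=> oU; rewrite /whitney_open /= preimage_bigcup.
by apply: bigcup_open => i _; exact: oU.
Qed.

(* The finest topology making whitney_of continuous. *)
HB.instance Definition _ := isOpenTopological.Build whitney
  whitney_openT whitney_openI whitney_open_bigcup.

Lemma whitneyD_subproof (j : 'I_n) (f : whitney) :
  (fun b => f (incr_multi b j)) \in whitney_pred.
Proof.
case: f => _ /= /asboolP[F <-]; apply/asboolP.
have sF : smooth F by exact/asboolP/(valP F).
exists (SmoothFun (asboolT (smooth_partial j sF))).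
by apply/funext => b; apply/funext => x; rewrite /jet_on multiD_incr.
Qed.

Definition whitneyD (j : 'I_n) (f : whitney) : whitney :=
  Whitney (whitneyD_subproof j f).

Definition whitneyDv (v : 'rV[R]_n) (f : whitney) : whitney :=
  \sum_(j < n) (v 0 j)%:C *: whitneyD j f.

Definition whitney_polyD (p : {poly R[i]}) (v : 'rV[R]_n) (f : whitney) :
  whitney := \sum_(i < size p) p`_i *: iter i (whitneyDv v) f.

Definition whitney_PD (k : nat) (P : 'I_k -> {poly R[i]})
    (v : 'I_k -> 'rV[R]_n) : whitney -> whitney :=
  \big[(fun S T => S \o T)/id]_(m < k) whitney_polyD (P m) (v m).

End whitney.

Section normal.
Variables (R : realType) (n : nat).
Local Notation Rn := 'rV[R]_n.

Definition scalar_prod (x y : Rn) : R := \sum_(j < n) x 0 j * y 0 j.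

Definition orth_hyperplane (v : Rn) : set Rn := [set x | scalar_prod x v = 0].

Definition normal_along (v : Rn) (K Kv : set Rn) (phi psi : Kv -> R) : Prop :=
  [/\ compact Kv, Kv `<=` orth_hyperplane v, forall x, phi x <= psi x &
      K = [set y | exists (x : Kv) (t : R),
                     phi x <= t <= psi x /\ y = t *: v + val x]].

(* In the order of R[i], a <= b means that b - a is a nonnegative real, so the
   bounds on the component of order 0 of gamma force it to be real-valued. *)
Definition normal_smooth_surface (k : nat) (v : 'I_k -> Rn) (K : set Rn) :
    Prop :=
  forall m : 'I_k, exists (Kv : set Rn) (phi psi : Kv -> R),
    normal_along (v m) K phi psi /\
    exists gamma : whitney Kv, forall x : Kv,
      (phi x)%:C <= gamma [ffun=> 0%N] x <= (psi x)%:C.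

End normal.

(* Main.v *)
Require Import Defs.
From HB Require Import structures.
From mathcomp Require Import all_boot all_order all_algebra.
From mathcomp Require Import complex ring lra.
From mathcomp Require Import all_classical all_reals all_analysis.
Set Implicit Arguments.
Unset Strict Implicit.
Unset Printing Implicit Defensive.
Import Order.TTheory GRing.Theory Num.Theory numFieldNormedType.Exports.
Local Open Scope classical_set_scope.
Local Open Scope ring_scope.

(* P_1, ..., P_k split over R[i], so it suffices to invert D_v - lambda for one v.
   Write x in K as y + t v with y in K_v and let g be the real part of a smooth
   extension of gamma.  With q(x) = t - g(y), which satisfies D_v q = 1, the
   operator
     T F (x) = q(x) \int_0^1 e^{lambda u q(x)} F (x - u q(x) v) du,
   that is, the integral of e^{lambda (t - s)} F (y + s v) for s from g(y) to t,
   solves (D_v - lambda) T F = F on the whole of R^n.  For x in K the segment of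
   integration joins (y, g(y)) to (y, t) and stays in K, because phi <= g <= psi;
   since the derivatives of T F at x only involve derivatives of F along that
   segment, T maps functions flat on K to functions flat on K, and therefore
   descends to the quotient E(K). *)

(** * Directional derivatives *)

Section difference_quotient.
Context {R : realType} {V : normedModType R}.
Implicit Types (f : V -> R) (x y a b : V).

Lemma is_derive_cvg f x a (l : R) :
  h^-1 *: (f (x + h *: a) - f x) @[h --> (0 : R)^'] --> l -> is_derive x a f l.
Proof.
move=> fl.
have E : (fun h : R => h^-1 *: ((f \o shift x) (h *: a) - f x)) =
         (fun h : R => h^-1 *: (f (x + h *: a) - f x)).
  by apply/funext => h /=; rewrite [x + _]addrC.
split; first by rewrite /derivable E; exact: (cvgP l).
by rewrite /derive E; exact: cvg_lim.
Qed.

Lemma cvg_is_derive f x a (l : R) : is_derive x a f l ->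
  h^-1 *: (f (x + h *: a) - f x) @[h --> (0 : R)^'] --> l.
Proof.
move=> [df <-].
have E : (fun h : R => h^-1 *: ((f \o shift x) (h *: a) - f x)) =
         (fun h : R => h^-1 *: (f (x + h *: a) - f x)).
  by apply/funext => h /=; rewrite [x + _]addrC.
by move: df; rewrite /derive /derivable E.
Qed.

End difference_quotient.

Section directional_derivatives.
Context {R : realType} {V : normedModType R}.
Implicit Types (f : V -> R) (x y a b : V).

Lemma is_derive_lineP f x a (l : R) :
  is_derive (0 : R) (1 : R) (fun t : R => f (x + t *: a)) l <->
  is_derive x a f l.
Proof.
have E : (fun h : R => h^-1 *: (f (x + (0 + h *: (1 : R)) *: a) - f (x + (0 : R) *: a))) =
         (fun h : R => h^-1 *: (f (x + h *: a) - f x)).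
  by apply/funext => h /=; rewrite add0r scale0r addr0 [h *: 1]mulr1.
split=> d; apply: is_derive_cvg; last by rewrite E; exact: cvg_is_derive.
by rewrite -E; exact: cvg_is_derive.
Qed.

(** Bounding the intermediate point by [|s|], instead of placing it in an interval, treats both
    signs of [s] at once. As [s] tends to 0 this bound forces [c] to 0. *)
Lemma MVT_line f b y (s : R) : (forall z, derivable f z b) ->
  exists c : R, `|c| <= `|s| /\ f (y + s *: b) - f y = s * 'D_b f (y + c *: b).
Proof.
move=> db.
have dg (t : R) : is_derive t (1 : R) (fun t : R => f (y + t *: b))
    ('D_b f (y + t *: b)) by exact: is_derive_line.
have cg (u w : R) : {within `[u, w], continuous (fun t : R => f (y + t *: b))}.
  by apply: derivable_within_continuous => t _; case: (dg t).
have [s0|s0] := leP 0 s.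
  have [c] := MVT_segment s0 (fun t _ => dg t) (cg _ _).
  rewrite in_itv/= scale0r addr0 subr0 mulrC => /andP[c0 cs] E; exists c; split=> //.
  by rewrite !ger0_norm.
have [c] := MVT_segment (ltW s0) (fun t _ => dg t) (cg _ _).
rewrite in_itv/= scale0r addr0 sub0r => /andP[c0 cs] E; exists c; split.
  by rewrite !ler0_norm ?lerN2// ltW.
by rewrite -[LHS]opprB E mulrN opprK mulrC.
Qed.

(** A chain rule obtained without total differentiability: the derivative along [a] enters only at
    [x], and the one along [b] is carried to nearby points by its continuity. *)
Lemma is_derive_curve f x a b (p : R -> R) (dp : R) :
  (forall z, derivable f z b) -> continuous ('D_b f) -> derivable f x a ->
  is_derive (0 : R) (1 : R) p dp -> p 0 = 0 ->
  is_derive (0 : R) (1 : R) (fun t : R => f (x + t *: a + p t *: b))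
    ('D_a f x + dp * 'D_b f x).
Proof.
move=> db cb da pd p0.
have /choice[c cP] (t : R) := MVT_line (x + t *: a) (p t) db.
apply: is_derive_cvg.
(* The increment is split into one along [a] starting at [x] and one along [b], and the latter is
   rewritten with the mean value point [c h]. *)
have -> : (fun h : R => h^-1 *: (f (x + (0 + h *: (1 : R)) *: a + p (0 + h *: (1 : R)) *: b)
     - f (x + (0 : R) *: a + p 0 *: b))) =
   (fun h : R => h^-1 *: (f (x + h *: a) - f x) +
     h^-1 *: (p (0 + h *: (1 : R)) - p 0) * 'D_b f (x + h *: a + c h *: b)).
  apply/funext => h /=; rewrite !add0r [h *: 1]mulr1 p0 !scale0r subr0 !addr0.
  rewrite -scalerAl -(proj2 (cP h)) -scalerDr; congr (_ *: _).
  by rewrite [RHS]addrC addrA subrK.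
apply: cvgD; first exact/cvg_is_derive/derivableP.
apply: cvgM; first exact: cvg_is_derive.
have p_cvg : p h @[h --> (0 : R)^'] --> (0 : R).
  rewrite -[X in _ --> X]p0; apply: cvg_within_filter.
  by apply/differentiable_continuous/derivable1_diffP; case: pd.
(* The point [c h] is squeezed to 0 by [|p h|], so the argument of ['D_b f] tends to [x]. *)
have c_cvg : c h @[h --> (0 : R)^'] --> (0 : R).
  apply/norm_cvg0P; apply: (@squeeze_cvgr _ _ _ _ (cst 0) (fun h => `|p h|)).
  - by near=> h; rewrite normr_ge0 /=; case: (cP h).
  - exact: cvg_cst.
  - by rewrite -[X in _ --> X](normr0 R); exact: cvg_norm.
apply: (@continuous_cvg _ _ _ _ _ (fun h => x + h *: a + c h *: b) ('D_b f) x).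
  exact: cb.
rewrite -[X in _ --> X]addr0 -[X in _ --> _ + X](scale0r b).
apply: cvgD; last exact: cvgZl.
rewrite -[X in _ --> X]addr0 -[X in _ --> _ + X](scale0r a).
apply: cvgD; first exact: cvg_cst.
by apply: cvgZl; apply: cvg_within.
Unshelve. all: by end_near. Qed.

End directional_derivatives.

(** * Integrals over the unit interval *)

Lemma continuous_pair (S A B : topologicalType) (a : S -> A) (b : S -> B) :
  continuous a -> continuous b -> continuous (fun s => (a s, b s)).
Proof. by move=> ca cb s; apply: cvg_pair; [exact: ca|exact: cb]. Qed.

Lemma continuous2_comp (S A B C : topologicalType) (F : A -> B -> C)
    (a : S -> A) (b : S -> B) : continuous (fun p => F p.1 p.2) ->
  continuous a -> continuous b -> continuous (fun s => F (a s) (b s)).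
Proof.
move=> cF ca cb s.
apply: (@continuous_comp _ _ _ (fun s => (a s, b s)) (fun p => F p.1 p.2)).
  exact: continuous_pair.
exact: cF.
Qed.

Section unit_integral.
Context {R : realType}.
Implicit Types (f g : R -> R) (c M : R).

Definition int01 f : R := \int[lebesgue_measure]_(u in `[0, 1]) f u.

Lemma integrable01 f : continuous f ->
  (@lebesgue_measure R).-integrable `[0, 1] (EFin \o f).
Proof.
move=> cf; apply: continuous_compact_integrable; first exact: segment_compact.
exact: continuous_subspaceT.
Qed.

Lemma eq_int01 f g : (forall u, 0 <= u <= 1 -> f u = g u) -> int01 f = int01 g.
Proof.
by move=> fg; apply: eq_Rintegral => u; rewrite inE/= in_itv/=; exact: fg.
Qed.

Lemma int01_lin c f g : continuous f -> continuous g ->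
  int01 (fun u => c * f u + g u) = c * int01 f + int01 g.
Proof.
move=> cf cg; rewrite /int01 RintegralD ?RintegralZl//; try exact: integrable01.
by apply: (@integrable01 (fun u => c * f u)) => u; apply: cvgMr; exact: cf.
Qed.

Lemma int01_0 : int01 (fun=> 0) = 0.
Proof. by rewrite /int01 Rintegral_cst//= mul0r. Qed.

Lemma int01_le M f : continuous f -> (forall u, 0 <= u <= 1 -> `|f u| <= M) ->
  `|int01 f| <= M.
Proof.
move=> cf fM; have cst1 : int01 (cst M) = M.
  by rewrite /int01 Rintegral_cst///= lebesgue_measure_itv/= lte01 -EFinB /= subr0 mulr1.
rewrite -[leRHS]cst1; apply: le_trans (le_normr_Rintegral _ (integrable01 cf)) _ => //.
apply: le_Rintegral => //.
- apply: (@integrable01 (fun u => `|f u|)) => u; apply: cvg_norm; exact: cf.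
- by apply: integrable01 => u; exact: cvg_cst.
Qed.

Lemma int01_derive F f : continuous f -> (forall u : R, is_derive u (1 : R) F (f u)) ->
  int01 f = F 1 - F 0.
Proof.
move=> cf dF; have cF : continuous F.
  by move=> u; apply/differentiable_continuous/derivable1_diffP; case: (dF u).
rewrite /int01 /Rintegral (@continuous_FTC2 _ f F)//.
- exact: continuous_subspaceT.
- split=> [u _||]; first by case: (dF u).
    by apply: cvg_at_right_filter; exact: cF.
  by apply: cvg_at_left_filter; exact: cF.
- by move=> u _; rewrite derive1E; case: (dF u).
Qed.

(** A tube lemma: compactness of the unit interval merges the neighbourhoods found at each [u] into
    a single neighbourhood of [t0]. *)
Lemma near_uniform01 (T : topologicalType) (H : T * R -> R) (t0 : T) (e : R) :
  continuous H -> 0 < e ->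
  \forall t \near t0, forall u, 0 <= u <= 1 -> `|H (t0, u) - H (t, u)| < e.
Proof.
move=> cH e0; have e20 : 0 < e / 2 by rewrite divr_gt0.
have : \forall t \near t0, `[0, 1]%classic `<=` (fun u => `|H (t0, u) - H (t, u)| < e).
  move/compact_near_coveringP : (@segment_compact R 0 1); apply.
  move=> u _; have /cvgrPdist_lt/(_ _ e20)[[/= A B] [At Bu] AB] := cH (t0, u).
  exists (B, A) => [//|[u' t] /= [Bu' At']].
  have H1 := AB (t0, u') (conj (nbhs_singleton At) Bu').
  have H2 := AB (t, u') (conj At' Bu').
  rewrite (splitr e) -(subrKA (H (t0, u))).
  by apply: le_lt_trans (ler_normD _ _) (ltrD _ H2); rewrite distrC.
by apply: filterS => t tH u u01; apply: tH; rewrite /= in_itv.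
Qed.

(** By the mean value theorem the difference quotient of [h u] is [h' u] at a point [x + c v] with
    [|c| <= |t|]. By [near_uniform01] it differs from [h' u x] by less than [e], uniformly in [u],
    for small [t]. *)
Lemma is_derive_int01 (V : normedModType R) (h h' : R -> V -> R) (v x : V) :
  (forall u z, is_derive z v (h u) (h' u z)) ->
  (forall z, continuous (h ^~ z)) ->
  continuous (fun p : R * V => h' p.1 p.2) ->
  is_derive x v (fun z => int01 (h ^~ z)) (int01 (h' ^~ x)).
Proof.
move=> dh ch ch'; apply: is_derive_cvg; apply/cvgrPdist_le => e e0.
pose H (q : R * R) := h' q.2 (x + q.1 *: v).
have cH : continuous H.
  apply: (continuous2_comp ch' (a := snd)) => q; first exact: cvg_snd.
  by apply: cvgD; [exact: cvg_cst|apply: cvgZl; exact: cvg_fst].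
have ch'x : continuous (h' ^~ x).
  apply: (continuous2_comp ch' (a := id) (b := fun=> x)); last exact: cst_continuous.
  by move=> u W.
have /nbhs_ballP[d /= d0 Hd] := near_uniform01 (0 : R) cH e0.
apply/nbhs_ballP; exists d => //= t; rewrite -ball_normE /ball_/= sub0r normrN => td t0.
have chD : continuous (fun u => -1 * h u x + h u (x + t *: v)).
  by move=> u; apply: cvgD; [apply: cvgMr|]; exact: ch.
set a := int01 (h ^~ (x + _)); set b := int01 (h ^~ x).
(* The whole error is gathered under one integral, so that a bound on the integrand suffices. *)
have -> : int01 (h' ^~ x) - t^-1 *: (a - b) =
    int01 (fun u => - t^-1 * (-1 * h u x + h u (x + t *: v)) + h' u x).
  rewrite (int01_lin (- t^-1) chD ch'x) (int01_lin (-1) (ch x) (ch (x + t *: v))).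
  by rewrite -/a -/b /GRing.scale/=; ring.
apply: int01_le => [u|u u01].
  by apply: cvgD; [apply: cvgMr; exact: chD|exact: ch'x].
have [z|c [ct E]] := @MVT_line _ _ (h u) v x t; first by case: (dh u z).
rewrite mulN1r [- h _ _ + _]addrC E mulrA mulNr mulVf // mulN1r addrC.
have -> : 'D_v (h u) (x + c *: v) = h' u (x + c *: v) by case: (dh u (x + c *: v)).
have := Hd c _ u u01; rewrite -ball_normE /ball_/= sub0r normrN /H /= scale0r addr0.
by move=> /(_ (le_lt_trans ct td))/ltW.
Qed.

End unit_integral.

(** * Families of smooth functions *)

Section partial_derivatives.
Context {R : realType} {n : nat}.
Local Notation Rn := 'rV[R]_n.
Implicit Types (f : Rn -> R) (v x : Rn).

(** The coordinates of [v] are added one at a time, each by [is_derive_curve] with the linear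
    function [p t = v 0 j * t]. *)
Lemma is_derive_partials f v x :
  (forall j z, derivable f z (unitv R j)) ->
  (forall j, continuous ('D_(unitv R j) f)) ->
  is_derive x v f (\sum_(j < n) v 0 j * 'D_(unitv R j) f x).
Proof.
move=> df cf.
have {1}-> : v = \sum_(j < n) v 0 j *: unitv R j by exact: row_sum_delta.
elim: (index_enum _) => [|j r IHr]; first by rewrite !big_nil; exact: is_derive0.
rewrite !big_cons addrC [_ + \sum_(i <- r) _]addrC; apply/is_derive_lineP.
set a := \sum_(i <- r) (_ *: _) in IHr *; set l := \sum_(i <- r) (_ * _) in IHr *.
have -> : (fun t : R => f (x + t *: (a + v 0 j *: unitv R j))) =
    (fun t => f (x + t *: a + (v 0 j * t) *: unitv R j)).
  by apply/funext => t; rewrite scalerDr addrA scalerA mulrC.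
case: IHr => da <-; apply: is_derive_curve => //; last by rewrite mulr0.
have := is_deriveZ (v 0 j) (is_derive_id (0 : R) (1 : R)).
by rewrite [_ *: 1]mulr1.
Qed.

End partial_derivatives.

Section smooth_families.
Context {R : realType} {n : nat}.
Local Notation Rn := 'rV[R]_n.

Definition pd {Y : Type} (j : 'I_n) (h : Y -> Rn -> R) : Y -> Rn -> R :=
  fun y => 'D_(unitv R j) (h y).

(* The set Z records where the family and its derivatives vanish, so that one
   induction proves smoothness, continuity in the parameter and preservation of
   flatness. *)
Fixpoint Ck {Y : topologicalType} (Z : Y -> Rn -> Prop) (k : nat)
    (h : Y -> Rn -> R) : Prop :=
  [/\ continuous (fun p : Y * Rn => h p.1 p.2),
      forall y x, Z y x -> h y x = 0 &
      if k is k'.+1 then forall j,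
        (forall y x, derivable (h y) x (unitv R j)) /\ Ck Z k' (pd j h)
      else True].

Definition nowhere {Y : Type} (y : Y) (x : Rn) : Prop := False.

Section families.
Context {Y : topologicalType}.
Implicit Types (Z : Y -> Rn -> Prop) (h f c s : Y -> Rn -> R).

Lemma Ck_continuous Z k h : Ck Z k h -> continuous (fun p : Y * Rn => h p.1 p.2).
Proof. by case: k => [|k] []. Qed.

Lemma Ck_continuous_at Z k h y : Ck Z k h -> continuous (h y).
Proof.
move=> /Ck_continuous ch.
by apply: (continuous2_comp ch (a := fun=> y) (b := id)); [exact: cst_continuous|by move=> z W].
Qed.

Lemma Ck_vanish Z k h y x : Ck Z k h -> Z y x -> h y x = 0.
Proof. by case: k => [|k] [_ h0 _]; exact: h0. Qed.

Lemma CkS_derivable Z k h j y x : Ck Z k.+1 h -> derivable (h y) x (unitv R j).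
Proof. by case=> _ _ /(_ j)[]. Qed.

Lemma CkS_pd Z k h j : Ck Z k.+1 h -> Ck Z k (pd j h).
Proof. by case=> _ _ /(_ j)[]. Qed.

Lemma CkS_is_derive Z k h v y x : Ck Z k.+1 h ->
  is_derive x v (h y) (\sum_(j < n) v 0 j * pd j h y x).
Proof.
move=> hS; apply: is_derive_partials => j; first by move=> z; exact: CkS_derivable hS.
exact: Ck_continuous_at (CkS_pd j hS).
Qed.

Lemma CkSI Z k h : continuous (fun p : Y * Rn => h p.1 p.2) ->
  (forall y x, Z y x -> h y x = 0) ->
  (forall j, exists2 h', (forall y x, is_derive x (unitv R j) (h y) (h' y x)) &
     Ck Z k h') -> Ck Z k.+1 h.
Proof.
move=> ch h0 dh; split=> // j; have [h' d Ch'] := dh j.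
split=> [y x|]; first by case: (d y x).
suff -> : pd j h = h' by [].
by apply/funext => y; apply/funext => x; case: (d y x).
Qed.

Lemma CkW Z k h : Ck Z k.+1 h -> Ck Z k h.
Proof.
elim: k h => [|k IHk] h [ch h0 dh]; split=> // j.
by have [d /IHk] := dh j.
Qed.

Lemma Ck_le Z Z' k h : (forall y x, Z' y x -> Z y x) -> Ck Z k h -> Ck Z' k h.
Proof.
move=> ZZ'; elim: k h => [|k IHk] h [ch h0 dh]; split=> //.
- by move=> y x /ZZ'; exact: h0.
- by move=> y x /ZZ'; exact: h0.
- by move=> j; have [d /IHk] := dh j.
Qed.

Lemma Ck_cst k (c : Y -> R) : continuous c -> Ck nowhere k (fun y _ => c y).
Proof.
elim: k c => [|k IHk] c cc.
  by split=> // p; apply: (@continuous_comp _ _ _ fst c); [exact: cvg_fst|exact: cc].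
apply: CkSI => // [p|j].
  by apply: (@continuous_comp _ _ _ fst c); [exact: cvg_fst|exact: cc].
exists (fun _ _ => 0); last by apply: (IHk (fun _ => 0)) => y; exact: cvg_cst.
by move=> y x; exact: is_derive_cst.
Qed.

Lemma CkD Z k h f : Ck Z k h -> Ck Z k f -> Ck Z k (fun y x => h y x + f y x).
Proof.
elim: k h f => [|k IHk] h f hS fS.
  split=> // [p|y x zx].
    by apply: cvgD; [exact: (Ck_continuous hS)|exact: (Ck_continuous fS)].
  by rewrite (Ck_vanish hS) // (Ck_vanish fS) // addr0.
apply: CkSI => // [p|y x zx|j].
- by apply: cvgD; [exact: (Ck_continuous hS)|exact: (Ck_continuous fS)].
- by rewrite (Ck_vanish hS) // (Ck_vanish fS) // addr0.
exists (fun y x => pd j h y x + pd j f y x); last first.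
  by apply: IHk; exact: CkS_pd.
move=> y x; apply: is_deriveD; apply: derivableP.
  exact: CkS_derivable hS.
exact: CkS_derivable fS.
Qed.

(** Every term of Leibniz' rule contains [h] or one of its derivatives, so vanishing on [Z] is
    inherited from [h] alone. *)
Lemma CkM Z k c h : Ck nowhere k c -> Ck Z k h -> Ck Z k (fun y x => c y x * h y x).
Proof.
elim: k c h => [|k IHk] c h cS hS.
  split=> // [p|y x zx].
    by apply: cvgM; [exact: (Ck_continuous cS)|exact: (Ck_continuous hS)].
  by rewrite (Ck_vanish hS) // mulr0.
apply: CkSI => // [p|y x zx|j].
- by apply: cvgM; [exact: (Ck_continuous cS)|exact: (Ck_continuous hS)].
- by rewrite (Ck_vanish hS) // mulr0.
exists (fun y x => c y x * pd j h y x + pd j c y x * h y x); last first.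
  apply: CkD; apply: IHk; [exact: CkW|exact: CkS_pd|exact: CkS_pd|exact: CkW].
move=> y x; rewrite [pd j c y x * _]mulrC.
apply: (@is_deriveM _ _ (c y) (h y) x (unitv R j)); apply: derivableP.
  exact: CkS_derivable cS.
exact: CkS_derivable hS.
Qed.

Lemma CkZ Z k (a : R) h : Ck Z k h -> Ck Z k (fun y x => a * h y x).
Proof. by apply: CkM; apply: (Ck_cst _ (c := fun=> a)) => y; exact: cvg_cst. Qed.

Lemma CkN Z k h : Ck Z k h -> Ck Z k (fun y x => - h y x).
Proof.
move=> /(CkZ (-1)).
by rewrite (_ : (fun y x => -1 * h y x) = (fun y x => - h y x)) //;
  apply/funext => y; apply/funext => x; rewrite mulN1r.
Qed.

Lemma CkB Z k h f : Ck Z k h -> Ck Z k f -> Ck Z k (fun y x => h y x - f y x).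
Proof. by move=> hS /CkN; exact: CkD. Qed.

Lemma Ck_sum Z k (I : Type) (r : seq I) (h : I -> Y -> Rn -> R) :
  (forall i, Ck Z k (h i)) -> Ck Z k (fun y x => \sum_(i <- r) h i y x).
Proof.
move=> hS; elim: r => [|i r IHr].
  under eq_fun do under eq_fun do rewrite big_nil.
  elim: k {hS h} => [|k IHk].
    by split=> // p; exact: cvg_cst.
  apply: CkSI => // [p|j]; first exact: cvg_cst.
  by exists (fun _ _ => 0) => // y x; exact: is_derive_cst.
under eq_fun do under eq_fun do rewrite big_cons.
exact: CkD.
Qed.

(** The derivative along the [j]-th unit vector is [(D_j f)(x - s v) - (D_j s) (D_v f)(x - s v)],
    again built from shifted functions of the same kind, so induction on [k] applies. *)
Lemma Ck_shift Z Z0 k f s (v : Rn) : Ck Z0 k f -> Ck nowhere k s ->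
  (forall y x, Z y x -> Z0 y (x - s y x *: v)) ->
  Ck Z k (fun y x => f y (x - s y x *: v)).
Proof.
move=> fS sS ZZ0.
have cts f' : Ck Z0 0 f' ->
    continuous (fun p : Y * Rn => f' p.1 (p.2 - s p.1 p.2 *: v)).
  move=> f'S; apply: (continuous2_comp (Ck_continuous f'S)) => p.
    exact: cvg_fst.
  by apply: cvgB; [exact: cvg_snd|apply: cvgZl; exact: (Ck_continuous sS)].
have Ck0 k' f' : Ck Z0 k' f' -> Ck Z0 0 f'.
  by move=> f'S; split=> //; [exact: Ck_continuous f'S|move=> y x; exact: Ck_vanish f'S].
elim: k f fS sS => [|k IHk] f fS sS.
  by split; [exact: cts|move=> y x /ZZ0; exact: Ck_vanish fS|].
apply: CkSI; [exact/cts/(Ck0 _ _ fS)|by move=> y x /ZZ0; exact: Ck_vanish fS|].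
move=> j.
exists (fun y x => pd j f y (x - s y x *: v) +
    - (pd j s y x * \sum_(i < n) v 0 i * pd i f y (x - s y x *: v))).
  move=> y x; apply/is_derive_lineP; set x' := x - s y x *: v.
  (* A coordinate line through [x] is sent to the curve [x' + t e_j + p(t) v] with
     [p(t) = s(x) - s(x + t e_j)], which vanishes at 0 as [is_derive_curve] demands. *)
  have -> : (fun t : R => f y (x + t *: unitv R j - s y (x + t *: unitv R j) *: v)) =
      (fun t => f y (x' + t *: unitv R j +
                     (s y x - s y (x + t *: unitv R j)) *: v)).
    apply/funext => t; congr (f y _); rewrite /x' scalerBl.
    by rewrite [x - _ + _]addrAC subrKA.
  have dv z := CkS_is_derive v y z fS.
  have -> : \sum_(i < n) v 0 i * pd i f y x' = 'D_v (f y) x' by case: (dv x').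
  rewrite -mulNr; apply: is_derive_curve.
  - by move=> z; case: (dv z).
  - have -> : 'D_v (f y) = (fun z => \sum_(i < n) v 0 i * pd i f y z).
      by apply/funext => z; case: (dv z).
    have : Ck Z0 k (fun y z => \sum_(i < n) v 0 i * pd i f y z).
      by apply: Ck_sum => i; apply: CkZ; exact: CkS_pd.
    exact: Ck_continuous_at.
  - exact: CkS_derivable fS.
  - have d : is_derive (0 : R) (1 : R) (fun t : R => s y (x + t *: unitv R j))
        (pd j s y x).
      by apply/is_derive_lineP; apply: derivableP; exact: CkS_derivable sS.
    by have := is_deriveB (is_derive_cst (s y x) (0 : R) (1 : R)) d; rewrite sub0r.
  - by rewrite scale0r addr0 subrr.
apply: CkD; first by apply: IHk; [exact: CkS_pd|exact: CkW].
apply: CkN; apply: CkM; first exact: CkS_pd.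
apply: Ck_sum => i; apply: CkZ; apply: IHk; [exact: CkS_pd|exact: CkW].
Qed.

(** The index set [A] holds a family of one-variable functions closed under differentiation, with
    [d] acting on the indices. The induction therefore runs over all [a] simultaneously. *)
Lemma Ck_comp (A : Type) (Phi : A -> R -> R) (d : A -> A) k s :
  (forall a (t : R), is_derive t (1 : R) (Phi a) (Phi (d a) t)) ->
  Ck nowhere k s -> forall a, Ck nowhere k (fun y x => Phi a (s y x)).
Proof.
move=> dPhi sS.
have cts a : continuous (fun p : Y * Rn => Phi a (s p.1 p.2)).
  move=> p; apply: (@continuous_comp _ _ _ (fun p : Y * Rn => s p.1 p.2) (Phi a)).
    exact: (Ck_continuous sS).
  by apply/differentiable_continuous/derivable1_diffP; case: (dPhi a (s p.1 p.2)).
elim: k sS => [|k IHk] sS a; first by split.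
apply: CkSI => // j; exists (fun y x => Phi (d a) (s y x) * pd j s y x); last first.
  by apply: CkM; [exact/IHk/CkW|exact: CkS_pd].
move=> y x; apply/is_derive_lineP.
apply: (@is_derive1_comp _ (Phi a) (fun t => s y (x + t *: unitv R j))).
  by rewrite scale0r addr0; exact: dPhi.
apply/is_derive_lineP; apply: derivableP; exact: CkS_derivable sS.
Qed.

End families.

Lemma Ck_pull (Y Y' : topologicalType) (w : Y' -> Y) Z k (h : Y -> Rn -> R) :
  continuous w -> Ck Z k h -> Ck (fun y => Z (w y)) k (fun y => h (w y)).
Proof.
move=> cw; elim: k h => [|k IHk] h [ch h0 dh].
all: have cts : continuous (fun p : Y' * Rn => h (w p.1) p.2).
1,3: apply: (continuous2_comp ch) => p; last exact: cvg_snd.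
1,2: by apply: (@continuous_comp _ _ _ fst w); [exact: cvg_fst|exact: cw].
- by split=> // y x; exact: h0.
- split=> // [y x|j]; first exact: h0.
  by have [d /IHk] := dh j; split=> // y x; exact: d.
Qed.

(** The integration variable is treated as a further parameter, next to [y]. Derivatives pass under
    the integral by [is_derive_int01], and an integrand vanishing for all [u] in the unit interval
    has integral 0. *)
Lemma Ck_int01 (Y : topologicalType) (Z : Y -> Rn -> Prop)
    (Z' : (Y * R)%type -> Rn -> Prop) k (h : Y * R -> Rn -> R) :
  (forall y x u, Z y x -> 0 <= u <= 1 -> Z' (y, u) x) -> Ck Z' k h ->
  Ck Z k (fun y x => int01 (fun u => h (y, u) x)).
Proof.
move=> ZZ'.
have cu k' h' y x : Ck Z' k' h' -> continuous (fun u => h' (y, u) x).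
  move=> h'S; apply: (continuous2_comp (Ck_continuous h'S) (a := fun u => (y, u))).
    by apply: continuous_pair; [exact: cst_continuous|by move=> u W].
  exact: cst_continuous.
have cts k' h' : Ck Z' k' h' ->
    continuous (fun p : Y * Rn => int01 (fun u => h' (p.1, u) p.2)).
  move=> h'S p0; apply/cvgrPdist_le => e e0.
  pose H (q : (Y * Rn) * R) := h' (q.1.1, q.2) q.1.2.
  have cH : continuous H.
    apply: (continuous2_comp (Ck_continuous h'S) (a := fun q => (q.1.1, q.2))).
      apply: continuous_pair => q; last exact: cvg_snd.
      by apply: (@continuous_comp _ _ _ fst fst); exact: cvg_fst.
    by move=> q; apply: (@continuous_comp _ _ _ fst snd); [exact: cvg_fst|exact: cvg_snd].
  apply: filterS (near_uniform01 p0 cH e0) => p Hp.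
  have c0 := cu _ _ p0.1 p0.2 h'S; have c1 := cu _ _ p.1 p.2 h'S.
  rewrite addrC -mulN1r -int01_lin //.
  apply: int01_le => [u|u u01]; last by rewrite mulN1r addrC; exact/ltW/Hp.
  by apply: cvgD; [apply: cvgMr; exact: c1|exact: c0].
elim: k h => [|k IHk] h hS.
  split=> //; first exact: cts hS.
  move=> y x zx; rewrite -[RHS](@int01_0 R); apply: eq_int01 => u u01.
  by apply: (Ck_vanish hS); exact: ZZ'.
apply: CkSI; first exact: cts hS.
  move=> y x zx; rewrite -[RHS](@int01_0 R); apply: eq_int01 => u u01.
  by apply: (Ck_vanish hS); exact: ZZ'.
move=> j; exists (fun y x => int01 (fun u => pd j h (y, u) x)); last first.
  exact/IHk/CkS_pd.
move=> y x; have h'S := CkS_pd j hS.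
apply: (is_derive_int01 (h := fun u => h (y, u)) (h' := fun u => pd j h (y, u))).
- by move=> u z; apply: derivableP; exact: CkS_derivable hS.
- by move=> z; exact: cu hS.
apply: (continuous2_comp (Ck_continuous h'S) (a := fun q : R * Rn => (y, q.1))) => q.
  by apply: continuous_pair => // z; [exact: cvg_cst|exact: cvg_fst].
exact: cvg_snd.
Qed.

End smooth_families.

(** * The topology of the space of smooth functions *)

Section complex_families.
Context {R : realType} {n : nat}.
Local Notation Rn := 'rV[R]_n.
Local Notation smooth_fun := (smooth_fun R n).

Lemma continuous_complex (S : topologicalType) (a b : S -> R) :
  continuous a -> continuous b -> continuous (fun s => (a s +i* b s)%C : R[i]).
Proof.
(* In the order of [R[i]] a positive tolerance has imaginary part 0, so it reduces to a real
   [e > 0]. *)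
move=> ca cb s; apply/cvgrPdist_lt => -[e e'] /=; rewrite ltcE/= => /andP[/eqP -> e0].
have e20 : 0 < e / 2 by rewrite divr_gt0.
near=> t.
have : `|a s - a t| < e / 2 by near: t; have /cvgrPdist_lt := ca s; exact.
have : `|b s - b t| < e / 2 by near: t; have /cvgrPdist_lt := cb s; exact.
rewrite !ltr_norml normc_def/= ltcR => /andP[B1 B2] /andP[A1 A2].
rewrite -[ltRHS](gtr0_norm e0) -sqrtr_sqr ltr_sqrt ?exprn_gt0//.
by nra.
Unshelve. all: by end_near. Qed.

Lemma locally_compact_rV : locally_compact [set: Rn].
Proof.
move=> x _; rewrite withinET; exists (closed_ball x 1).
  by apply/nbhs_closedballP; exists 1%:pos.
split; last exact: closed_ball_closed.
apply: bounded_closed_compact; last exact: closed_ball_closed.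
rewrite closed_ballE //; exists (`|x| + 1); split; first exact: num_real.
move=> M xM y; rewrite /closed_ball_/= => xy; apply: le_trans (ltW xM).
by rewrite -[y](subKr x) (le_trans (ler_normB _ _)) // lerD2l.
Qed.

Section compact_open.
Import ArrowAsCompactOpen.

(* On continuous functions the topology of uniform convergence on compact sets
   is the compact-open topology, for which currying is a bijection. *)
Lemma continuous_uncurry_family (Y : topologicalType)
    (f : Y -> {family compact, Rn -> R[i]}) :
  continuous f -> (forall y, continuous (f y : Rn -> R[i])) ->
  continuous (fun p : Y * Rn => f p.1 p.2).
Proof.
move=> cf cfy.
have : continuous (f : Y -> (Rn -> R[i])).
  by move=> y; apply/compact_open_fam_compactP; [exact: cfy|exact: cf].
move=> /(continuous_uncurry locally_compact_rV (@norm_hausdorff _ _)) /(_ cfy).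
by rewrite (_ : uncurry f = (fun p => f p.1 p.2))//; apply/funext => -[].
Qed.

Lemma continuous_curry_family (Y : topologicalType)
    (f : Y -> {family compact, Rn -> R[i]}) :
  continuous (fun p : Y * Rn => f p.1 p.2) -> continuous f.
Proof.
move=> /(@continuous_curry _ _ _ (fun p : Y * Rn => f p.1 p.2))[cf cfy] y.
by apply/compact_open_fam_compactP; [exact: cfy|exact: cf].
Qed.

End compact_open.

Definition word_multi (s : seq 'I_n) : multi_index n :=
  [ffun j => count_mem j s].

(** The topology is indexed by multi-indices while the inductions run over words of derivatives;
    commuting partial derivatives identify the two. *)
Lemma partials_multiD s (F : Rn -> R[i]) : smooth F ->
  partials s F = multiD (word_multi s) F.
Proof.
move=> sF; apply: partials_perm => //; apply/allP => j _ /=; apply/eqP.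
rewrite /multi_word count_flatten -map_comp sumnE big_map/=.
under eq_bigr do rewrite count_nseq ffunE.
rewrite (bigD1_seq j) ?mem_enum ?enum_uniq//= eqxx mul1n big1 ?addn0//.
by move=> i /negPf /=; rewrite eq_sym => ->.
Qed.

Lemma smooth_funP (F : smooth_fun) : smooth F.
Proof. exact/asboolP/(valP F). Qed.

(** Joint continuity is what allows the space of smooth functions to serve as the parameter space of
    a family. *)
Lemma continuous_eval s : continuous (fun p : smooth_fun * Rn => partials s p.1 p.2).
Proof.
have -> : (fun p : smooth_fun * Rn => partials s p.1 p.2) =
    (fun p => all_derivatives p.1 (word_multi s) p.2).
  by apply/funext => -[F x]; rewrite partials_multiD //; exact: smooth_funP.
apply: (@continuous_uncurry_family smooth_fun (fun F => all_derivatives F (word_multi s))).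
  move=> F; apply: (@continuous_comp _ _ _ (@all_derivatives R n)
    (@proj (multi_index n) (fun=> {family compact, Rn -> R[i]}) (word_multi s))).
    exact: initial_continuous.
  exact: proj_continuous.
by move=> F; rewrite /all_derivatives -partials_multiD; [case: (smooth_funP F s)|exact: smooth_funP].
Qed.

(** Counterpart of [continuous_eval]: the topology is initial for the derivatives, and each of them
    is handled by currying. *)
Lemma continuous_smooth_fun (Y : topologicalType) (T : Y -> smooth_fun) :
  (forall s, continuous (fun p : Y * Rn => partials s (T p.1) p.2)) -> continuous T.
Proof.
move=> cT; apply: continuous_comp_initial => y; apply/cvg_sup => b.
apply: (@continuous_comp_initial _ _ {family compact, Rn -> R[i]}
  (fun f : prod_topology (fun _ : multi_index n => {family compact, Rn -> R[i]}) => f b)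
  (fun y => all_derivatives (T y))).
exact: (@continuous_curry_family Y (fun y => multiD b (T y)) (cT (multi_word b))).
Qed.


End complex_families.

(** * Families parametrised by the space of smooth functions *)

Section smooth_fun_families.
Context {R : realType} {n : nat}.
Local Notation Rn := 'rV[R]_n.
Local Notation smooth_fun := (smooth_fun R n).

(** The functions flat at every point of [K] form the kernel of [whitney_of K]; an operator
    preserving them descends to the quotient. *)
Definition flat (F : smooth_fun) (x : Rn) : Prop := forall s, partials s F x = 0.

(** The universal family, with [F] itself as parameter: differentiating only lengthens the word [s],
    and [flat] makes all the derivatives vanish. *)
Lemma Ck_eval_Re s k :
  Ck flat k (fun (F : smooth_fun) x => complex.Re (partials s F x)).
Proof.
have cts t : continuous (fun p : smooth_fun * Rn => complex.Re (partials t p.1 p.2)).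
  move=> p; apply: (@continuous_comp _ _ _ (fun p : smooth_fun * Rn => partials t p.1 p.2)
    (@complex.Re R)); [exact: continuous_eval|exact: continuous_Re].
have fl t F x : flat F x -> complex.Re (partials t F x) = 0 by move=> ->.
elim: k s => [|k IHk] s; first by split => //; exact: fl.
apply: CkSI => // [F x|j]; first exact: fl.
exists (fun (F : smooth_fun) x => complex.Re (partials (j :: s) F x)) => // F x.
by have [_ /(_ j x)[d _]] := smooth_funP F s; exact: derivableP.
Qed.

Lemma Ck_eval_Im s k :
  Ck flat k (fun (F : smooth_fun) x => complex.Im (partials s F x)).
Proof.
have cts t : continuous (fun p : smooth_fun * Rn => complex.Im (partials t p.1 p.2)).
  move=> p; apply: (@continuous_comp _ _ _ (fun p : smooth_fun * Rn => partials t p.1 p.2)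
    (@complex.Im R)); [exact: continuous_eval|exact: continuous_Im].
have fl t F x : flat F x -> complex.Im (partials t F x) = 0 by move=> ->.
elim: k s => [|k IHk] s; first by split => //; exact: fl.
apply: CkSI => // [F x|j]; first exact: fl.
exists (fun (F : smooth_fun) x => complex.Im (partials (j :: s) F x)) => // F x.
by have [_ /(_ j x)[_ d]] := smooth_funP F s; exact: derivableP.
Qed.

(** Collects the three outputs of the [Ck] induction: values that are smooth functions, continuity
    of the operator, and flatness. *)
Lemma Ck_smooth_fun (Y : topologicalType) (Z : Y -> Rn -> Prop)
    (h1 h2 : Y -> Rn -> R) :
  (forall k, Ck Z k h1) -> (forall k, Ck Z k h2) ->
  exists T : Y -> smooth_fun,
    [/\ forall y, T y = (fun x => (h1 y x +i* h2 y x)%C) :> (Rn -> R[i]),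
        continuous T & forall y x, Z y x -> flat (T y) x].
Proof.
move=> C1 C2; pose pds s (h : Y -> Rn -> R) := foldr pd h s.
have Cpds s h : (forall k, Ck Z k h) -> forall k, Ck Z k (pds s h).
  by move=> Ch; elim: s => [//|j s IHs] k; exact: CkS_pd.
have E s y : partials s (fun x => (h1 y x +i* h2 y x)%C) =
    (fun x => (pds s h1 y x +i* pds s h2 y x)%C) by elim: s => //= j s ->.
have sm y : smooth (fun x => (h1 y x +i* h2 y x)%C).
  move=> s; rewrite E; split=> [|j x].
    by apply: continuous_complex; apply: (@Ck_continuous_at _ _ _ Z 0); exact: Cpds.
  by split; apply: (@CkS_derivable _ _ _ Z 0); exact: Cpds.
exists (fun y => SmoothFun (asboolT (sm y))); split=> //.
  apply: continuous_smooth_fun => s; under eq_fun do rewrite /= E.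
  by apply: continuous_complex; apply: (@Ck_continuous _ _ _ Z 0); exact: Cpds.
move=> y x zx s; rewrite /= E.
by rewrite !(@Ck_vanish _ _ _ Z 0) //; exact: Cpds.
Qed.

End smooth_fun_families.

(** * Real and imaginary parts of complex exponentials *)

Section damped_rotation.
Context {R : realType}.
Variables (a b : R).

(* Re (mu e^{lambda t}) for lambda = a + i b and mu = m.1 - i m.2 *)
Definition exp_osc (m : R * R) (t : R) : R :=
  expR (a * t) * (m.1 * cos (b * t) + m.2 * sin (b * t)).

(** Differentiation multiplies [mu] by [lambda], which gives the new pair of coordinates. The family
    is thus closed under derivation, in the form used by [Ck_comp]. *)
Lemma is_derive_exp_osc m (t : R) :
  is_derive t (1 : R) (exp_osc m) (exp_osc (a * m.1 + b * m.2, a * m.2 - b * m.1) t).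
Proof.
have da : is_derive t (1 : R) (fun t => expR (a * t)) (expR (a * t) * a).
  apply: (@is_derive1_comp _ expR (fun t => a * t)).
  by have := is_deriveZ a (is_derive_id t (1 : R)); rewrite [_ *: 1]mulr1.
have lb : is_derive t (1 : R) (fun t => b * t) b.
  by have := is_deriveZ b (is_derive_id t (1 : R)); rewrite [_ *: 1]mulr1.
have dc : is_derive t (1 : R) (fun t => cos (b * t)) (- sin (b * t) * b).
  exact: (@is_derive1_comp _ cos (fun t => b * t)).
have ds : is_derive t (1 : R) (fun t => sin (b * t)) (cos (b * t) * b).
  exact: (@is_derive1_comp _ sin (fun t => b * t)).
have := is_deriveM da (is_deriveD (is_deriveZ m.1 dc) (is_deriveZ m.2 ds)).
move=> d; apply: is_derive_eq; rewrite /exp_osc /GRing.scale /=.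
by rewrite !fctE /GRing.scale/= /GRing.scale/=; ring.
Qed.

End damped_rotation.

(** * Integration along a line *)

Section line_integral.
Context {R : realType} {n : nat}.
Local Notation Rn := 'rV[R]_n.
Variables (a b : R) (v : Rn) (q : Rn -> R).
Hypothesis qC : forall (Y : topologicalType) k, Ck nowhere k (fun (_ : Y) x => q x).
Hypothesis q_line : forall x (t : R), q (x + t *: v) = q x + t.

(** The real and imaginary parts of [e^{lambda t}]. *)
Local Notation e1 := (exp_osc a b (1, 0)).
Local Notation e2 := (exp_osc a b (0, 1)).

Lemma is_derive_e1 (t : R) : is_derive t (1 : R) e1 (a * e1 t - b * e2 t).
Proof.
have := is_derive_exp_osc a b (1, 0) t => d; apply: is_derive_eq.
by rewrite /exp_osc /=; ring.
Qed.

Lemma is_derive_e2 (t : R) : is_derive t (1 : R) e2 (a * e2 t + b * e1 t).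
Proof.
have := is_derive_exp_osc a b (0, 1) t => d; apply: is_derive_eq.
by rewrite /exp_osc /=; ring.
Qed.

(** The common shape of the kernel, as a function along [v], and of its antiderivative in [u]. *)
Lemma is_derive_mulB (t : R) (p g1 g2 B1 B2 : R -> R) (dp dg1 dg2 dB1 dB2 : R) :
  is_derive t (1 : R) p dp -> is_derive t (1 : R) g1 dg1 ->
  is_derive t (1 : R) g2 dg2 -> is_derive t (1 : R) B1 dB1 ->
  is_derive t (1 : R) B2 dB2 ->
  is_derive t (1 : R) (fun s => p s * (g1 s * B1 s - g2 s * B2 s))
    (dp * (g1 t * B1 t - g2 t * B2 t) +
     p t * (dg1 * B1 t + g1 t * dB1 - dg2 * B2 t - g2 t * dB2)).
Proof.
move=> Dp D1 D2 F1 F2.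
have d := is_deriveM Dp (is_deriveB (is_deriveM D1 F1) (is_deriveM D2 F2)).
by apply: is_derive_eq; rewrite !fctE /GRing.scale/=; ring.
Qed.

Section families.
Context {Y : topologicalType}.
Implicit Types (Z : Y -> Rn -> Prop) (f : Y -> Rn -> R).

(* Real part of q e^{lambda u q} f (x - u q v) for f = f1 + i f2. *)
Definition line_kernel f1 f2 (p : Y * R) (x : Rn) : R :=
  q x * (e1 (p.2 * q x) * f1 p.1 (x - (p.2 * q x) *: v) -
         e2 (p.2 * q x) * f2 p.1 (x - (p.2 * q x) *: v)).

(** The real part of [T f]. Its imaginary part is the same expression for [-i f], that is, for the
    pair [f2], [- f1]. *)
Definition line_int f1 f2 (y : Y) (x : Rn) : R :=
  int01 (fun u => line_kernel f1 f2 (y, u) x).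

Lemma Ck_line_kernel Z k f1 f2 : Ck Z k f1 -> Ck Z k f2 ->
  Ck (fun (p : Y * R) (x : Rn) => Z p.1 (x - (p.2 * q x) *: v)) k (line_kernel f1 f2).
Proof.
move=> S1 S2.
have sS : Ck nowhere k (fun (p : Y * R) x => p.2 * q x).
  apply: CkM; last exact: qC.
  by apply: (Ck_cst k (c := fun p : Y * R => p.2)) => p; exact: cvg_snd.
have shift f : Ck Z k f -> Ck (fun (p : Y * R) (x : Rn) => Z p.1 (x - (p.2 * q x) *: v)) k
    (fun (p : Y * R) x => f p.1 (x - (p.2 * q x) *: v)).
  move=> fS; apply: (Ck_shift (Z0 := fun p => Z p.1) (f := fun p => f p.1)) sS _ => //.
  by apply: Ck_pull => // p; exact: cvg_fst.
have eS m : Ck nowhere k (fun (p : Y * R) x => exp_osc a b m (p.2 * q x)).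
  exact: (Ck_comp (is_derive_exp_osc a b) sS).
apply: CkM; first exact: qC.
by apply: CkB; (apply: CkM; [exact: eS|exact: shift]).
Qed.

Lemma Ck_line_int Z k f1 f2 : Ck Z k f1 -> Ck Z k f2 ->
  Ck (fun y x => forall u, 0 <= u <= 1 -> Z y (x - (u * q x) *: v)) k
     (line_int f1 f2).
Proof.
move=> S1 S2; apply: Ck_int01 (Ck_line_kernel S1 S2) => y x u; exact.
Qed.

Lemma continuous_line_kernel Z k f1 f2 y x : Ck Z k f1 -> Ck Z k f2 ->
  continuous (fun u => line_kernel f1 f2 (y, u) x).
Proof.
move=> S1 S2.
apply: (continuous2_comp (Ck_continuous (Ck_line_kernel S1 S2))
  (a := pair y) (b := fun=> x)); last exact: cst_continuous.
by apply: continuous_pair; [exact: cst_continuous|move=> u W].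
Qed.

Lemma line_intN Z k f1 f2 y x : Ck Z k f1 -> Ck Z k f2 ->
  line_int (fun y x => - f1 y x) (fun y x => - f2 y x) y x = - line_int f1 f2 y x.
Proof.
move=> S1 S2; have c0 : continuous (fun _ : R => 0 : R) by exact: cst_continuous.
rewrite -[RHS]addr0 -mulN1r -[X in _ + X]int01_0.
rewrite -(int01_lin (-1) (continuous_line_kernel (y := y) (x := x) S1 S2) c0).
by congr int01; apply/funext => u; rewrite /line_kernel; ring.
Qed.

(** This is the real part of [D_v (T f) = lambda T f + f]. The term [f1] is the boundary
    contribution of an exact [u]-derivative. *)
Lemma is_derive_line_int Z f1 f2 y x : Ck Z 1 f1 -> Ck Z 1 f2 ->
  is_derive x v (line_int f1 f2 y)
    (a * line_int f1 f2 y x - b * line_int f2 (fun y x => - f1 y x) y x + f1 y x).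
Proof.
move=> S1 S2; pose f1N y x := - f1 y x; rewrite -/f1N.
have S1N : Ck Z 1 f1N by exact: CkN.
have kS := Ck_line_kernel S1 S2.
pose k' u z := \sum_(j < n) v 0 j * pd j (line_kernel f1 f2) (y, u) z.
have dk' u z : is_derive z v (line_kernel f1 f2 (y, u)) (k' u z).
  exact: CkS_is_derive kS.
have ck' : continuous (fun p : R * Rn => k' p.1 p.2).
  have sS : Ck (fun (p : Y * R) (x : Rn) => Z p.1 (x - (p.2 * q x) *: v)) 0
      (fun p z => \sum_(j < n) v 0 j * pd j (line_kernel f1 f2) p z).
    by apply: Ck_sum => j; apply: CkZ; exact: CkS_pd.
  apply: (continuous2_comp (Ck_continuous sS) (a := fun p : R * Rn => (y, p.1))).
    by apply: continuous_pair; [exact: cst_continuous|move=> p; exact: cvg_fst].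
  by move=> p; exact: cvg_snd.
have ck'x : continuous (k' ^~ x).
  apply: (continuous2_comp ck' (a := id) (b := fun=> x)); last exact: cst_continuous.
  by move=> u W.
have c1 := continuous_line_kernel (y := y) (x := x) S1 S2.
have c2 := continuous_line_kernel (y := y) (x := x) S2 S1N.
suff <- : int01 (k' ^~ x) =
    a * line_int f1 f2 y x - b * line_int f2 f1N y x + f1 y x.
  apply: (is_derive_int01 (h := fun u => line_kernel f1 f2 (y, u))) => //.
  by move=> z; exact: continuous_line_kernel S1 S2.
(* The factor [u - 1] kills the end [u = 1] and leaves [- f1 y x] at [u = 0], whence
   [K 1 - K 0 = f1 y x]. *)
pose K u := (u - 1) * (e1 (u * q x) * f1 y (x - (u * q x) *: v) -
                       e2 (u * q x) * f2 y (x - (u * q x) *: v)).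
pose K' u := - a * line_kernel f1 f2 (y, u) x +
  (b * line_kernel f2 f1N (y, u) x + k' u x).
have cK' : continuous K'.
  move=> u; apply: cvgD; first by apply: cvgMr; exact: c1.
  by apply: cvgD; [apply: cvgMr; exact: c2|exact: ck'x].
(* The derivative of the kernel along v, minus lambda times the kernel, is the
   u-derivative of (u - 1) e^{lambda u q} f (x - u q v). *)
have dK (u : R) : is_derive u (1 : R) K (K' u).
  pose d f := \sum_(j < n) v 0 j * pd j f y (x - (u * q x) *: v).
  have df f : Ck Z 1 f -> is_derive (x - (u * q x) *: v) v (f y) (d f).
    exact: CkS_is_derive.
  (* The kernel is followed along [x + t v]: there [q] grows by [t], so the argument of [f] moves by
     [(1 - u) t] in the direction [v]. *)
  have k'E : k' u x = 1 * (e1 (u * q x) * f1 y (x - (u * q x) *: v) -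
                       e2 (u * q x) * f2 y (x - (u * q x) *: v)) +
    q x * ((a * e1 (u * q x) - b * e2 (u * q x)) * u * f1 y (x - (u * q x) *: v)
          + e1 (u * q x) * (d f1 * (1 - u))
          - (a * e2 (u * q x) + b * e1 (u * q x)) * u * f2 y (x - (u * q x) *: v)
          - e2 (u * q x) * (d f2 * (1 - u))).
    have id1 : is_derive (0 : R) (1 : R) (fun t : R => q x + t) 1.
      by have := is_deriveD (is_derive_cst (q x) (0 : R) (1 : R)) (is_derive_id (0 : R) 1);
        rewrite add0r.
    have uid1 : is_derive (0 : R) (1 : R) (fun t : R => u * (q x + t)) u.
      by have := is_deriveZ u id1; rewrite [_ *: 1]mulr1.
    have lid1 : is_derive (0 : R) (1 : R) (fun t : R => (1 - u) * t) (1 - u).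
      by have := is_deriveZ (1 - u) (is_derive_id (0 : R) (1 : R)); rewrite [_ *: 1]mulr1.
    have dline f : Ck Z 1 f -> is_derive (0 : R) (1 : R)
        (fun t : R => f y ((x - (u * q x) *: v) + ((1 - u) * t) *: v)) (d f * (1 - u)).
      move=> fS; apply: (@is_derive1_comp _
        (fun t => f y ((x - (u * q x) *: v) + t *: v)) (fun t => (1 - u) * t)) => //.
      by rewrite mulr0; apply/is_derive_lineP; exact: df.
    have de1 : is_derive (0 : R) (1 : R) (fun t : R => e1 (u * (q x + t)))
        ((a * e1 (u * q x) - b * e2 (u * q x)) * u).
      apply: (@is_derive1_comp _ e1 (fun t => u * (q x + t))) => //.
      by rewrite addr0; exact: is_derive_e1.
    have de2 : is_derive (0 : R) (1 : R) (fun t : R => e2 (u * (q x + t)))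
        ((a * e2 (u * q x) + b * e1 (u * q x)) * u).
      apply: (@is_derive1_comp _ e2 (fun t => u * (q x + t))) => //.
      by rewrite addr0; exact: is_derive_e2.
    have := is_derive_mulB id1 de1 de2 (dline _ S1) (dline _ S2).
    rewrite !addr0 mulr0 scale0r !addr0 => D.
    have /is_derive_lineP D' := dk' u x.
    suff E : (fun t : R => line_kernel f1 f2 (y, u) (x + t *: v)) = (fun s =>
        (q x + s) * (e1 (u * (q x + s)) * f1 y (x - (u * q x) *: v + ((1 - u) * s) *: v) -
                     e2 (u * (q x + s)) * f2 y (x - (u * q x) *: v + ((1 - u) * s) *: v))).
      by rewrite E in D'; case: D => _ <-; case: D' => _ <-.
    apply/funext => t; rewrite /line_kernel /= q_line.
    suff -> : x + t *: v - (u * (q x + t)) *: v =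
        x - (u * q x) *: v + ((1 - u) * t) *: v by [].
    rewrite -!addrA; congr (_ + _); rewrite -!scaleNr -!scalerDl.
    by congr (_ *: _); rewrite /GRing.scale/=; ring.
  have idB : is_derive u (1 : R) (fun t : R => t - 1) 1.
    by have := is_deriveB (is_derive_id u (1 : R)) (is_derive_cst (1 : R) u 1); rewrite subr0.
  have idq : is_derive u (1 : R) (fun t : R => t * q x) (q x).
    have := is_deriveZ (q x) (is_derive_id u (1 : R)); rewrite [_ *: 1]mulr1.
    by congr is_derive; apply/funext => t; rewrite /= mulrC.
  have dline f : Ck Z 1 f -> is_derive u (1 : R)
      (fun t : R => f y (x - (t * q x) *: v)) (d f * - q x).
    move=> fS; have -> : (fun t : R => f y (x - (t * q x) *: v)) =
        (fun t : R => f y (x + (- (t * q x)) *: v)).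
      by apply/funext => t; rewrite scaleNr.
    apply: (@is_derive1_comp _ (fun t => f y (x + t *: v)) (fun t => - (t * q x))).
      have := df f fS; rewrite -scaleNr => -[Df <-].
      exact: is_derive_line.
  have de1 : is_derive u (1 : R) (fun t : R => e1 (t * q x))
      ((a * e1 (u * q x) - b * e2 (u * q x)) * q x).
    exact: (@is_derive1_comp _ e1 (fun t => t * q x)) (is_derive_e1 _) idq.
  have de2 : is_derive u (1 : R) (fun t : R => e2 (t * q x))
      ((a * e2 (u * q x) + b * e1 (u * q x)) * q x).
    exact: (@is_derive1_comp _ e2 (fun t => t * q x)) (is_derive_e2 _) idq.
  have := is_derive_mulB idB de1 de2 (dline _ S1) (dline _ S2).
  move=> D; apply: is_derive_eq.
  by rewrite /K' k'E /line_kernel /f1N /=; ring.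
have -> : k' ^~ x = (fun u => a * line_kernel f1 f2 (y, u) x +
    (- b * line_kernel f2 f1N (y, u) x + K' u)).
  by apply/funext => u; rewrite /K'; ring.
have cbK' : continuous (fun u => - b * line_kernel f2 f1N (y, u) x + K' u).
  by move=> u; apply: cvgD; [apply: cvgMr; exact: c2|exact: cK'].
rewrite (int01_lin a c1 cbK') (int01_lin (- b) c2 cK') (int01_derive cK' dK).
rewrite -/(line_int f1 f2 y x) -/(line_int f2 f1N y x) /K /exp_osc.
rewrite !mul0r !mulr0 scale0r subr0 expR0 cos0 sin0.
by rewrite /=; ring.
Qed.

End families.
End line_integral.

(** * A right inverse of [D_v - lambda] on smooth functions *)

Section smooth_right_inverse.
Context {R : realType} {n : nat}.
Local Notation Rn := 'rV[R]_n.
Local Notation smooth_fun := (smooth_fun R n).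

Lemma Ck_coord (Y : topologicalType) (i : 'I_n) k :
  Ck nowhere k (fun (_ : Y) (x : Rn) => x 0 i).
Proof.
have cts : continuous (fun p : Y * Rn => p.2 0 i).
  move=> p; apply: (@continuous_comp _ _ _ snd (fun x : Rn => x 0 i)).
    exact: cvg_snd.
  exact: coord_continuous.
case: k => [|k]; first by split.
apply: CkSI => // j; exists (fun _ _ => unitv R j 0 i); last first.
  by apply: (Ck_cst k (c := fun=> _)); exact: cst_continuous.
move=> y x; apply/is_derive_lineP.
have -> : (fun t : R => (x + t *: unitv R j) 0 i) =
    (fun t => x 0 i + unitv R j 0 i * t).
  by apply/funext => t; rewrite mxE [in X in _ + X]mxE mulrC.
have := is_deriveD (is_derive_cst (x 0 i) (0 : R) (1 : R))
  (is_deriveZ (unitv R j 0 i) (is_derive_id (0 : R) (1 : R))).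
by rewrite add0r [_ *: 1]mulr1.
Qed.

(** For nonzero [v], the coordinate [t] in [x = t v + y] with [y] orthogonal to [v]. *)
Definition height (v x : Rn) : R := scalar_prod x v / scalar_prod v v.

Lemma scalar_prodDl (x y v : Rn) :
  scalar_prod (x + y) v = scalar_prod x v + scalar_prod y v.
Proof.
rewrite /scalar_prod -big_split /=; apply: eq_bigr => j _.
by rewrite mxE mulrDl.
Qed.

Lemma scalar_prodZl (t : R) (x v : Rn) :
  scalar_prod (t *: x) v = t * scalar_prod x v.
Proof. by rewrite /scalar_prod mulr_sumr; apply: eq_bigr => j _; rewrite mxE mulrA. Qed.

Lemma scalar_prod_gt0 (v : Rn) : v != 0 -> 0 < scalar_prod v v.
Proof.
move=> v0; rewrite lt0r sumr_ge0 ?andbT; last by move=> j _; rewrite -expr2 sqr_ge0.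
apply: contra v0; rewrite psumr_eq0; last by move=> j _; rewrite -expr2 sqr_ge0.
move=> /allP v0; apply/eqP/rowP => j; apply/eqP; rewrite mxE.
by have := v0 j (mem_index_enum _); rewrite mulf_eq0 orbb.
Qed.

Lemma heightD (v x : Rn) (t : R) : v != 0 -> height v (x + t *: v) = height v x + t.
Proof.
move=> v0; rewrite /height scalar_prodDl scalar_prodZl mulrDl mulfK//.
by rewrite gt_eqF// scalar_prod_gt0.
Qed.

Lemma Ck_height (Y : topologicalType) (v : Rn) k :
  Ck nowhere k (fun (_ : Y) x => height v x).
Proof.
rewrite /height /scalar_prod; under eq_fun do under eq_fun do rewrite mulr_suml.
apply: Ck_sum => i.
under eq_fun do under eq_fun do rewrite -mulrA mulrC.
by apply: CkZ; exact: Ck_coord.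
Qed.

(* Signed height, along v, of x over the graph of Re G above the hyperplane
   orthogonal to v. *)
Definition height_over (G : smooth_fun) (v x : Rn) : R :=
  height v x - complex.Re (G (x - height v x *: v)).

Lemma height_overD G v x (t : R) : v != 0 ->
  height_over G v (x + t *: v) = height_over G v x + t.
Proof.
move=> v0; rewrite /height_over heightD // scalerDl opprD.
by rewrite [x + _ + _]addrACA subrr addr0 addrAC.
Qed.

(** The projection onto the hyperplane is itself a shift along [v], by the smooth amount
    [height v x], so [Ck_shift] applies to [G]. *)
Lemma Ck_height_over (Y : topologicalType) G v k :
  Ck nowhere k (fun (_ : Y) x => height_over G v x).
Proof.
apply: CkB; first exact: Ck_height.
apply: (@Ck_shift _ _ _ nowhere nowhere k (fun (_ : Y) x => complex.Re (G x))
  (fun _ x => height v x)) => //; last exact: Ck_height.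
apply: (@Ck_le _ _ _ (fun=> flat G)) => //.
apply: (@Ck_pull _ _ _ _ (fun _ : Y => G) (@flat R n) k
  (fun F x => complex.Re (partials [::] F x))); first exact: cst_continuous.
exact: Ck_eval_Re.
Qed.

Lemma smooth_fun_linE (c : R[i]) (F G : smooth_fun) (x : Rn) :
  (c *: F + G) x = c * F x + G x.
Proof.
have E : \val (c *: F + G) = c *: \val F + \val G by rewrite linearP.
by move: E => /= ->; rewrite !fctE.
Qed.

Lemma smooth_right_inverse (lambda : R[i]) (v : Rn) (G : smooth_fun) : v != 0 ->
  exists T : smooth_fun -> smooth_fun,
    [/\ continuous T, linear T,
        forall F x, \sum_(j < n) (v 0 j)%:C%C * partial j (T F) x -
          lambda * T F x = F x &
        forall F x, (forall u, 0 <= u <= 1 ->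
            flat F (x - (u * height_over G v x) *: v)) -> flat (T F) x].
Proof.
case: lambda => a b v0.
have qC (Y : topologicalType) k := Ck_height_over Y G v k.
have qD x (t : R) := height_overD G x t v0.
pose f1 (F : smooth_fun) x := complex.Re (F x).
pose f2 (F : smooth_fun) x := complex.Im (F x).
pose f1N F x := - f1 F x.
have S1 k : Ck (@flat R n) k f1 by exact: (Ck_eval_Re [::]).
have S2 k : Ck (@flat R n) k f2 by exact: (Ck_eval_Im [::]).
have S1N k : Ck (@flat R n) k f1N by exact: CkN.
pose H1 := line_int a b v (height_over G v) f1 f2.
(* The imaginary part of [T F], obtained as the real part for [-i F]. *)
pose H2 := line_int a b v (height_over G v) f2 f1N.
have CH1 k := Ck_line_int a b v qC (S1 k) (S2 k).
have CH2 k := Ck_line_int a b v qC (S2 k) (S1N k).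
have [T [TE cT flatT]] := Ck_smooth_fun CH1 CH2.
have kC g1 g2 F x : Ck (@flat R n) 0 g1 -> Ck (@flat R n) 0 g2 ->
    continuous (fun u => line_kernel a b v (height_over G v) g1 g2 (F, u) x).
  exact: (continuous_line_kernel qC).
have kC1 F x := kC f1 f2 F x (S1 0) (S2 0).
have kC2 F x := kC f2 f1N F x (S2 0) (S1N 0).
have int_lin (c d : R) (g1 g2 g3 : R -> R) : continuous g1 -> continuous g2 -> continuous g3 ->
    int01 (fun u => c * g1 u + (d * g2 u + g3 u)) = c * int01 g1 + (d * int01 g2 + int01 g3).
  move=> C1 C2 C3; have C23 : continuous (fun u => d * g2 u + g3 u).
    by move=> u; apply: cvgD; [apply: cvgMr; exact: C2|exact: C3].
  by rewrite (int01_lin c C1 C23) (int01_lin d C2 C3).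
exists T; split => //.
- move=> [c d] F F'; apply: val_inj; rewrite linearP /= !TE; apply/funext => x.
  have f1D z : f1 ((c +i* d)%C *: F + F') z = c * f1 F z + (- d * f2 F z + f1 F' z).
    rewrite /f1 /f2 smooth_fun_linE.
    by case: (F z) (F' z) => [? ?] [? ?] /=; ring.
  have f2D z : f2 ((c +i* d)%C *: F + F') z = c * f2 F z + (d * f1 F z + f2 F' z).
    rewrite /f1 /f2 smooth_fun_linE.
    by case: (F z) (F' z) => [? ?] [? ?] /=; ring.
  have H1D : H1 ((c +i* d)%C *: F + F') x = c * H1 F x + (- d * H2 F x + H1 F' x).
    rewrite -(int_lin c (- d) _ _ _ (kC1 F x) (kC2 F x) (kC1 F' x)).
    congr int01; apply/funext => u; rewrite /line_kernel /= f1D f2D /f1N; ring.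
  have H2D : H2 ((c +i* d)%C *: F + F') x = c * H2 F x + (d * H1 F x + H2 F' x).
    rewrite -(int_lin c d _ _ _ (kC2 F x) (kC1 F x) (kC2 F' x)).
    congr int01; apply/funext => u; rewrite /line_kernel /f1N /= f1D f2D; ring.
  rewrite !fctE /GRing.scale /= -/H1 -/H2 H1D H2D.
  by apply/eqP; rewrite eq_complex /=; apply/andP; split; apply/eqP; ring.
- move=> F x.
  have D1 := is_derive_line_int a b qC qD F x (S1 1) (S2 1).
  have D2 := is_derive_line_int a b qC qD F x (S2 1) (S1N 1).
  have E1 := CkS_is_derive v F x (CH1 1).
  have E2 := CkS_is_derive v F x (CH2 1).
  have {D1 E1}E1 : \sum_(j < n) v 0 j * pd j H1 F x = a * H1 F x - b * H2 F x + f1 F x.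
    by case: E1 => _ <-; case: D1.
  have {D2 E2}E2 : \sum_(j < n) v 0 j * pd j H2 F x = a * H2 F x + b * H1 F x + f2 F x.
    case: E2 => _ <-; case: D2 => _ ->; congr (_ + _ + _).
    (* Passing from [F] to [-i F] twice changes the sign; this turns the derivative formula for [H2]
       into the imaginary part of the equation. *)
    by rewrite (line_intN a b v qC F x (S1 0) (S2 0)) mulrN opprK.
  have -> : \sum_(j < n) (v 0 j)%:C%C * partial j (T F) x =
      ((\sum_(j < n) v 0 j * pd j H1 F x) +i* (\sum_(j < n) v 0 j * pd j H2 F x))%C.
    rewrite TE; elim: (index_enum _) => [|j r IHr]; first by rewrite !big_nil.
    by rewrite !big_cons IHr; apply/eqP; rewrite eq_complex /=; apply/andP; split;
      apply/eqP; rewrite /pd; ring.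
  rewrite E1 E2 TE -/H1 -/H2 /f1 /f2.
  by apply/eqP; rewrite eq_complex /=; apply/andP; split; apply/eqP; ring.
Qed.

End smooth_right_inverse.

(** * Passage to Whitney functions *)

Section whitney_right_inverse.
Context {R : realType} {n : nat} (K : set 'rV[R]_n).
Local Notation Rn := 'rV[R]_n.
Local Notation smooth_fun := (smooth_fun R n).
Local Notation whitney := (whitney K).

Lemma whitney_of_linear : linear (@whitney_of R n K).
Proof.
move=> c F G; apply: val_inj; rewrite linearP /=.
apply/funext => b; apply/funext => x; rewrite /jet_on /multiD /= partials_lin; try exact: smooth_funP.
by rewrite !fctE.
Qed.

HB.instance Definition _ :=
  GRing.isLinear.Build _ _ _ _ (@whitney_of R n K) whitney_of_linear.

Lemma whitney_ofP (f : whitney) : exists F : smooth_fun, whitney_of K F = f.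
Proof.
by case: f => f /[dup] /asboolP[F FE] fP; exists F; apply: val_inj.
Qed.

Lemma continuous_whitney_of : continuous (@whitney_of R n K).
Proof. by apply/continuousP => A. Qed.

Lemma whitney_of_flat (F G : smooth_fun) x : K x ->
  whitney_of K F = whitney_of K G -> flat (F - G) x.
Proof.
move=> Kx FG s; rewrite partials_multiD; last exact: smooth_funP.
have /(congr1 \val)/= E : whitney_of K (F - G) = 0.
  by rewrite linearB /= FG subrr.
have := congr1 (fun f => f (word_multi s) (SigSub (mem_set Kx))) E.
by [].
Qed.

Lemma flat_whitney_of (F : smooth_fun) : (forall x, K x -> flat F x) ->
  whitney_of K F = 0.
Proof.
move=> fl; apply: val_inj; apply/funext => b; apply/funext => x.
by rewrite /= /jet_on /multiD fl //; exact/set_mem/(valP x).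
Qed.

(** [S] applies [T] to a chosen extension. Two extensions differ by a function flat on [K], and [T]
    keeps it flat, so the class of the result does not depend on the choice. *)
Lemma whitney_operator (T : smooth_fun -> smooth_fun) :
  continuous T -> linear T ->
  (forall F, (forall x, K x -> flat F x) -> forall x, K x -> flat (T F) x) ->
  exists S : {linear whitney -> whitney},
    continuous S /\ forall F, S (whitney_of K F) = whitney_of K (T F).
Proof.
move=> cT lT flT.
pose lTm := GRing.isLinear.Build _ _ _ _ T lT.
pose T' : {linear smooth_fun -> smooth_fun} := HB.pack T lTm.
have /choice[e eP] := whitney_ofP.
pose S f := whitney_of K (T (e f)).
have SE F : S (whitney_of K F) = whitney_of K (T F).
  apply/eqP; rewrite -subr_eq0 -linearB; apply/eqP/flat_whitney_of.
  rewrite -[T _ - T F]/(T' _ - T' F) -linearB; apply: flT => x Kx.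
  by apply: whitney_of_flat => //; exact: eP.
have lS : linear S.
  move=> c f g; rewrite -{1}(eP f) -{1}(eP g) -linearP SE.
  by rewrite lT linearP.
pose lSm := GRing.isLinear.Build _ _ _ _ S lS.
pose S' : {linear whitney -> whitney} := HB.pack S lSm.
exists S'; split => //.
apply/continuousP => A oA.
(* In the quotient topology, openness of the preimage of [A] under [S] is tested after pulling it
   back to smooth functions, where it becomes a preimage under [whitney_of K] after [T]. *)
have : open ((fun F => whitney_of K (T F)) @^-1` A).
  move: A oA; apply/continuousP => F; apply: continuous_comp; first exact: cT.
  exact: continuous_whitney_of.
rewrite (_ : _ @^-1` A = whitney_of K @^-1` (S @^-1` A)) //.
by apply/funext => F; rewrite /preimage /= SE.
Qed.

End whitney_right_inverse.

(** * Linear factors and polynomials in [D_v] *)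

Section linear_factor.
Context {R : realType} {n : nat} (K : set 'rV[R]_n).
Local Notation Rn := 'rV[R]_n.
Local Notation smooth_fun := (smooth_fun R n).
Local Notation whitney := (whitney K).

Lemma whitneyD_linear j : linear (@whitneyD R n K j).
Proof.
move=> c f g; apply: val_inj; rewrite linearP /=.
apply/funext => b; apply/funext => x.
have E : \val (c *: f + g) = c *: \val f + \val g by rewrite linearP.
by move: E => /= ->; rewrite !fctE.
Qed.

HB.instance Definition _ j :=
  GRing.isLinear.Build _ _ _ _ (@whitneyD R n K j) (whitneyD_linear j).

Lemma whitneyDv_linear (v : Rn) : linear (@whitneyDv R n K v).
Proof.
move=> c f g; rewrite /whitneyDv scaler_sumr -big_split /=; apply: eq_bigr => j _.
by rewrite linearP scalerDr !scalerA [_ * c]mulrC.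
Qed.

HB.instance Definition _ (v : Rn) :=
  GRing.isLinear.Build _ _ _ _ (@whitneyDv R n K v) (whitneyDv_linear v).

Definition smooth_fun_partial (j : 'I_n) (F : smooth_fun) : smooth_fun :=
  SmoothFun (asboolT (smooth_partial j (smooth_funP F))).

Lemma whitneyD_of j (F : smooth_fun) :
  whitneyD j (whitney_of K F) = whitney_of K (smooth_fun_partial j F).
Proof.
apply: val_inj; apply/funext => b; apply/funext => x.
by rewrite /= /jet_on multiD_incr //; exact: smooth_funP.
Qed.

(** For [x = t v + y] the moving point has coordinate [t - u (t - g)], a convex combination of [t]
    and [g], which both lie in the interval from [phi y] to [psi y]. *)
Lemma normal_segment (v : Rn) (Kv : set Rn) (phi psi : Kv -> R) (G : smooth_fun)
    (x : Rn) (u : R) :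
  v != 0 -> normal_along v K phi psi ->
  (forall y : Kv, phi y <= complex.Re (G (val y)) <= psi y) ->
  0 <= u <= 1 -> K x -> K (x - (u * height_over G v x) *: v).
Proof.
move=> v0 [_ Kvv _ KE] Gy /andP[u0 u1]; rewrite KE => -[y [t [/andP[pt tp] ->]]].
have hy : height v (t *: v + val y) = t.
  rewrite addrC heightD // /height (Kvv (val y)) ?mul0r ?add0r //.
  exact/set_mem/(valP y).
have /andP[pg gp] := Gy y.
rewrite /height_over hy [t *: v + _ - t *: v]addrAC subrr add0r.
set g := complex.Re _ in pg gp *.
exists y, (t - u * (t - g)); split; last by rewrite scalerBl addrAC.
by apply/andP; split; nra.
Qed.

Lemma multi_word0 : multi_word [ffun=> 0%N] = [::] :> seq 'I_n.
Proof. by rewrite /multi_word; elim: (enum _) => //= j s ->; rewrite ffunE. Qed.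

Lemma linear_factor_right_inverse (lambda : R[i]) (v : Rn) (Kv : set Rn)
    (phi psi : Kv -> R) (gamma : Defs.whitney Kv) :
  v != 0 -> normal_along v K phi psi ->
  (forall y : Kv, (phi y)%:C%C <= gamma [ffun=> 0%N] y <= (psi y)%:C%C) ->
  exists S : {linear whitney -> whitney}, continuous S /\
    forall f, whitneyDv v (S f) - lambda *: S f = f.
Proof.
move=> v0 nK; have [G <- gG] := whitney_ofP gamma.
have {}gG y : phi y <= complex.Re (G (val y)) <= psi y.
  have := gG y; rewrite /= /jet_on /multiD multi_word0 /=.
  by case: (G _) => gr gi; rewrite !lecE /= => /andP[/andP[_ ->] /andP[_ ->]].
have [T [cT lT TE flT]] := smooth_right_inverse lambda G v0.
have [|S [cS SE]] := whitney_operator cT lT (K := K).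
  move=> F fl x Kx; apply: flT => u u01; apply: fl.
  exact: (normal_segment v0 nK gG u01 Kx).
exists S; split => // f; have [F <-] := whitney_ofP f; rewrite SE /whitneyDv.
under eq_bigr do rewrite whitneyD_of -linearZ.
rewrite -linear_sum -linearZ -linearB; congr whitney_of.
apply: val_inj; rewrite linearB linearZ linear_sum /=.
apply/funext => x; rewrite !fctE -[RHS](TE F x) fct_sumE scalerN.
by congr (_ - _); apply: eq_bigr => j _; rewrite !fctE.
Qed.

Lemma whitney_scaler (c : R[i]) : exists S : {linear whitney -> whitney},
  continuous S /\ forall f, S f = c *: f.
Proof.
(* Writing [c F] as [(c - 1) F + F] gives it the shape [a F + G] to which [partials_lin] applies. *)
pose T (F : smooth_fun) : smooth_fun := (c - 1) *: F + F.
have TE F : T F = c *: F by rewrite /T scalerBl scale1r subrK.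
have [||F fl x Kx s|S [cS SE]] := @whitney_operator _ _ K T.
- apply: continuous_smooth_fun => s.
  have E (F : smooth_fun) : partials s (T F) = (c - 1) *: partials s F + partials s F.
    by rewrite /T /= partials_lin //; exact: smooth_funP.
  under eq_fun do rewrite E.
  move=> p; apply: cvgD; last exact: continuous_eval.
  by apply: cvgMr; exact: continuous_eval.
- by move=> d F G; rewrite !TE scalerDr !scalerA mulrC.
- rewrite /T /= partials_lin; try exact: smooth_funP.
  by rewrite !fctE (fl x Kx s) scaler0 addr0.
exists S; split => // f; have [F <-] := whitney_ofP f.
by rewrite SE TE linearZ.
Qed.

Lemma whitney_polyD_widen (p : {poly R[i]}) (v : Rn) (f : whitney) N :
  (size p <= N)%N -> whitney_polyD p v f = \sum_(i < N) p`_i *: iter i (whitneyDv v) f.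
Proof.
move=> pN; rewrite /whitney_polyD (big_ord_widen N (fun i => p`_i *: iter i (whitneyDv v) f)) //.
rewrite big_mkcond; apply: eq_bigr => i _; case: ltnP => // pi.
by rewrite nth_default // scale0r.
Qed.

Lemma whitney_polyD_factor (lambda : R[i]) (q : {poly R[i]}) (v : Rn) (f : whitney) :
  whitney_polyD (('X - lambda%:P) * q) v f =
  whitneyDv v (whitney_polyD q v f) - lambda *: whitney_polyD q v f.
Proof.
(* An upper bound on the size is enough, since padding by zero coefficients leaves the operator
   unchanged; it also covers [q = 0]. *)
have sq : (size (('X - lambda%:P) * q)%R <= (size q).+1)%N.
  by apply: leq_trans (size_polyMleq _ _) _; rewrite size_XsubC.
rewrite (whitney_polyD_widen _ _ sq).
under eq_bigr do rewrite mulrBl coefB coefXM coefCM scalerBl.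
rewrite sumrB; congr (_ - _).
  (* Multiplication by ['X] shifts the coefficients: the term of order 0 vanishes and each other
     term carries one more [D_v]. *)
  rewrite big_ord_recl /= scale0r add0r /whitney_polyD linear_sum.
  by apply: eq_bigr => i _; rewrite linearZ.
rewrite (whitney_polyD_widen v f (leqnSn (size q))) scaler_sumr.
by apply: eq_bigr => i _; rewrite scalerA.
Qed.

(** Induction on the roots of [p] in the algebraically closed field [R[i]], starting from the
    leading coefficient, which is inverted by a scalar. *)
Lemma poly_right_inverse (p : {poly R[i]}) (v : Rn) : p != 0 ->
  (forall lambda, exists S : {linear whitney -> whitney}, continuous S /\
     forall f, whitneyDv v (S f) - lambda *: S f = f) ->
  exists S : {linear whitney -> whitney}, continuous S /\
    forall f, whitney_polyD p v (S f) = f.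
Proof.
move=> p0 Dv; have [r pE] := closed_field_poly_normal p.
have c0 : lead_coef p != 0 by rewrite lead_coef_eq0.
rewrite {}pE; elim: r => [|z r [S [cS SE]]].
  have [S [cS SE]] := whitney_scaler (lead_coef p)^-1.
  exists S; split => // f; rewrite big_nil /whitney_polyD alg_polyC size_polyC c0.
  by rewrite big_ord1 /= coefC /= SE scalerA mulfV // scale1r.
have [S1 [cS1 S1E]] := Dv z.
(* The factor [D_v - z] is applied last, so its inverse [S1] acts first. *)
exists (S \o S1); split => [f|f].
  by apply: continuous_comp; [exact: cS1|exact: cS].
by rewrite big_cons scalerAr whitney_polyD_factor /= SE S1E.
Qed.

End linear_factor.

(** * Composition over the directions *)

Theorem corollary3p3 (R : realType) (n k : nat) (P : 'I_k -> {poly R[i]})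
    (v : 'I_k -> 'rV[R]_n) (K : set 'rV[R]_n) :
  (forall m, P m != 0) -> (forall m, v m != 0) ->
  compact K -> normal_smooth_surface v K ->
  exists S : {linear whitney K -> whitney K},
    continuous S /\ whitney_PD P v \o S = id.
Proof.
move=> P0 v0 _ nK; rewrite /whitney_PD.
pose has_right_inverse (A : whitney K -> whitney K) :=
  exists S : {linear whitney K -> whitney K}, continuous S /\ A \o S = id.
(* Having a continuous linear right inverse holds for the identity and is stable under composition,
   which reduces the claim to one direction [v m]. *)
rewrite -/(has_right_inverse _); apply: big_ind => [|A B [S [cS SE]] [S' [cS' SE']]|m _].
- by exists idfun; split => // x; exact: cvg_id.
(* Right inverses compose in the opposite order. *)
- exists (S' \o S); split.
    by move=> f; apply: continuous_comp; [exact: cS|exact: cS'].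
  have E g : B (S' g) = g by rewrite -[RHS]/(id g) -SE'.
  by apply/funext => f; rewrite /= E -[RHS]/(id f) -SE.
have [Kv [phi [psi [nKm [gamma gP]]]]] := nK m.
have [S [cS SE]] := poly_right_inverse (P0 m)
  (fun lambda => linear_factor_right_inverse lambda (v0 m) nKm gP).
by exists S; split => //; apply/funext => f; exact: SE.
Qed.
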